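(* Let $K\subseteq\mathbb{R}^n$ be a closed convex semialgebraic set. Then $K$ is a spectrahedral shadow if and only if $f^\otimes(a)$ is a sum of squares in $R\otimes R$, for every real closed field $R\supseteq\mathbb{R}$, every $f\in(P_K)_R$ and every $a\in K_R$.
   Context: A spectrahedron is a subset of some $\mathbb{R}^s$ that is the solution set of a linear matrix inequality $A_0+\sum_{i=1}^sx_iA_i\succeq0$ with real symmetric matrices $A_i$; a spectrahedral shadow is the image of a spectrahedron under an affine-linear map $\mathbb{R}^s\to\mathbb{R}^n$. $P_K=\{f\in\mathbb{R}[x_1,\dots,x_n]\colon\deg(f)\le1,\ f|_K\ge0\}$, a semialgebraic convex cone in the space of polynomials of degree $\le1$. For a real closed field $R\supseteq\mathbb{R}$ and a semialgebraic set $M\subseteq\mathbb{R}^N$, $M_R\subseteq R^N$ is its base field extension, i.e. the set defined by the same finite boolean combination of polynomial inequalities; so $K_R\subseteq R^n$, and $(P_K)_R$ is a set of polynomials of degree $\le1$ in $R[x_1,\dots,x_n]$. $R\otimes R=R\otimes_{\mathbb{R}}R$. For $f=c_0+\sum_{i=1}^nc_ix_i$ with $c_i\in R$ and $a\in R^n$, the tensor evaluation is $f^\otimes(a)=1\otimes c_0+\sum_{i=1}^na_i\otimes c_i\in R\otimes R$. *)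

(* Defs.v *)
From HB Require Import structures.
From mathcomp Require Import all_boot all_order all_algebra generic_quotient.
From mathcomp Require Import boolp classical_sets reals topology normedtype convex.
From mathcomp.multinomials Require mpoly.
Set Implicit Arguments.
Unset Strict Implicit.
Unset Printing Implicit Defensive.

Import Order.TTheory GRing.Theory Num.Theory.
Import numFieldNormedType.Exports.

Local Open Scope classical_set_scope.
Local Open Scope ring_scope.

(* For commutative rings k and A and a ring morphism i : k -> A, tensor i is
   the ring A (x)_k A.  A formal sum of pure tensors is a list of pairs, and
   tensor_cong is the congruence generated by the defining relations of the
   tensor product; opposites need no generator since - (a (x) b) is the class
   of (- a) (x) b. *)
Section Tensor.
Variables (k A : comNzRingType) (i : {rmorphism k -> A}).

Inductive tensor_cong : seq (A * A) -> seq (A * A) -> Prop :=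
| tcong_refl t : tensor_cong t t
| tcong_sym t u : tensor_cong t u -> tensor_cong u t
| tcong_trans t u v : tensor_cong t u -> tensor_cong u v -> tensor_cong t v
| tcong_cat t t' u u' :
    tensor_cong t t' -> tensor_cong u u' -> tensor_cong (t ++ u) (t' ++ u')
| tcong_catC t u : tensor_cong (t ++ u) (u ++ t)
| tcong_0l b : tensor_cong [:: (0, b)] [::]
| tcong_Dl a a' b : tensor_cong [:: (a + a', b)] [:: (a, b); (a', b)]
| tcong_Dr a b b' : tensor_cong [:: (a, b + b')] [:: (a, b); (a, b')]
| tcong_scal r a b : tensor_cong [:: (i r * a, b)] [:: (a, i r * b)].

Definition tensor_rel : rel (seq (A * A)) := fun t u => `[< tensor_cong t u >].

Lemma tensor_rel_refl : reflexive tensor_rel.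
Proof. by move=> t; apply/asboolP; apply: tcong_refl. Qed.

Lemma tensor_rel_sym : symmetric tensor_rel.
Proof.
by move=> t u; apply/asboolP/asboolP; apply: tcong_sym.
Qed.

Lemma tensor_rel_trans : transitive tensor_rel.
Proof.
by move=> u t v /asboolP tu /asboolP uv; apply/asboolP; apply: tcong_trans uv.
Qed.

Canonical tensor_equiv :=
  EquivRel tensor_rel tensor_rel_refl tensor_rel_sym tensor_rel_trans.

Definition tensor := {eq_quot tensor_equiv}%qT.
HB.instance Definition _ := Choice.on tensor.

Definition tclass (t : seq (A * A)) : tensor := (\pi_({eq_quot tensor_equiv}) t)%qT.
Definition trepr (x : tensor) : seq (A * A) := repr (x : {eq_quot tensor_equiv}%qT).

Lemma treprK : cancel trepr tclass. Proof. exact: reprK. Qed.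

Lemma tclassP t u : tclass t = tclass u <-> tensor_cong t u.
Proof.
split=> [/eqmodP /asboolP // | tu]; by apply/eqmodP/asboolP.
Qed.

Lemma trepr_class t : tensor_cong (trepr (tclass t)) t.
Proof. by apply/tclassP; rewrite treprK. Qed.

Definition tadd (x y : tensor) := tclass (trepr x ++ trepr y).
Definition topp (x : tensor) := tclass [seq (- p.1, p.2) | p <- trepr x].

Lemma taddE t u : tadd (tclass t) (tclass u) = tclass (t ++ u).
Proof. by apply/tclassP; apply: tcong_cat; apply: trepr_class. Qed.

Lemma taddA : associative tadd.
Proof.
move=> x y z; rewrite -[x]treprK -[y]treprK -[z]treprK.
by rewrite !taddE catA.
Qed.

Lemma taddC : commutative tadd.
Proof. by move=> x y; apply/tclassP; apply: tcong_catC. Qed.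

Lemma tadd0 : left_id (tclass [::]) tadd.
Proof. by move=> x; rewrite -[x]treprK taddE. Qed.

Lemma taddN : left_inverse (tclass [::]) topp tadd.
Proof.
move=> x; rewrite -{2}[x]treprK taddE; apply/tclassP.
elim: (trepr x) => [|[a b] t IHt]; first exact: tcong_refl.
rewrite /= -cat1s -[(a, b) :: t]cat1s -[[::]]/([::] ++ [::]).
apply: (@tcong_trans _
  ([:: (- a, b)] ++ [:: (a, b)] ++ [seq (- p.1, p.2) | p <- t] ++ t)).
  apply: tcong_cat; first exact: tcong_refl.
  rewrite !catA; apply: tcong_cat; last exact: tcong_refl.
  exact: tcong_catC.
rewrite catA; apply: tcong_cat => //.
apply: (@tcong_trans _ [:: (- a + a, b)]).
  by apply: tcong_sym; apply: tcong_Dl.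
by rewrite addNr; apply: tcong_0l.
Qed.

HB.instance Definition _ :=
  GRing.isZmodule.Build tensor taddA taddC tadd0 taddN.

Lemma tclassD t u : tclass t + tclass u = tclass (t ++ u).
Proof. exact: taddE. Qed.

Definition pure (a b : A) : tensor := tclass [:: (a, b)].

Definition balanced (V : zmodType) (B : A -> A -> V) : Prop :=
  [/\ forall a a' b, B (a + a') b = B a b + B a' b,
      forall a b b', B a (b + b') = B a b + B a b' &
      forall r a b, B (i r * a) b = B a (i r * b)].

Lemma balanced0l (V : zmodType) (B : A -> A -> V) b : balanced B -> B 0 b = 0.
Proof.
case=> BD _ _; apply: (@addrI _ (B 0 b)).
by rewrite -BD !addr0.
Qed.

Definition tlift (V : zmodType) (B : A -> A -> V) (x : tensor) : V :=
  \sum_(p <- trepr x) B p.1 p.2.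

Lemma tliftE (V : zmodType) (B : A -> A -> V) t :
  balanced B -> tlift B (tclass t) = \sum_(p <- t) B p.1 p.2.
Proof.
move=> Bb; rewrite /tlift; have := trepr_class t.
move: (trepr _) => u; elim=> {t u} //=.
- by move=> t u v _ -> _ ->.
- by move=> t t' u u' _ Et _ Eu; rewrite !big_cat Et Eu.
- by move=> t u; rewrite !big_cat /= addrC.
- by move=> b; rewrite big_seq1 big_nil (balanced0l _ Bb).
- by case: Bb => BD _ _ a a' b; rewrite !big_cons !big_nil /= !addr0 BD.
- by case: Bb => _ BD _ a b b'; rewrite !big_cons !big_nil /= !addr0 BD.
- by case: Bb => _ _ BZ r a b; rewrite !big_seq1 BZ.
Qed.

Lemma tlift_pure (V : zmodType) (B : A -> A -> V) a b :
  balanced B -> tlift B (pure a b) = B a b.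
Proof. by move=> Bb; rewrite tliftE // big_seq1. Qed.

Lemma tliftD (V : zmodType) (B : A -> A -> V) x y :
  balanced B -> tlift B (x + y) = tlift B x + tlift B y.
Proof.
by move=> Bb; rewrite -[x]treprK -[y]treprK tclassD !tliftE // big_cat.
Qed.

Lemma tlift0 (V : zmodType) (B : A -> A -> V) : balanced B -> tlift B 0 = 0.
Proof. by move=> Bb; rewrite -[0]/(tclass [::]) tliftE // big_nil. Qed.

Lemma pure_balanced : balanced pure.
Proof.
split=> *; rewrite ?tclassD; apply/tclassP.
- exact: tcong_Dl.
- exact: tcong_Dr.
- exact: tcong_scal.
Qed.

Lemma tensor_ind (P : tensor -> Prop) :
  P 0 -> (forall a b x, P x -> P (pure a b + x)) -> forall x, P x.
Proof.
move=> P0 PD x; rewrite -[x]treprK; elim: (trepr x) => [|[a b] t IHt] //.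
by rewrite -cat1s -tclassD; apply: PD.
Qed.

Definition tmul (x y : tensor) : tensor :=
  tlift (fun a b => tlift (fun c d => pure (a * c) (b * d)) y) x.

Definition tone : tensor := pure 1 1.

Lemma balanced_mulr a b : balanced (fun c d => pure (a * c) (b * d)).
Proof.
have [Dl Dr Z] := pure_balanced.
by split=> [c c' d|c d d'|r c d]; rewrite ?mulrDr ?Dl ?Dr // !(mulrCA _ (i r)) Z.
Qed.

Lemma balanced_mull y :
  balanced (fun a b => tlift (fun c d => pure (a * c) (b * d)) y).
Proof.
have [Dl Dr Z] := pure_balanced.
split=> [a a' b|a b b'|r a b]; rewrite /tlift -?big_split /=;
  apply: eq_bigr => p _; by rewrite ?mulrDl ?Dl ?Dr // -!mulrA Z.
Qed.

Lemma tmul_pure a b c d : tmul (pure a b) (pure c d) = pure (a * c) (b * d).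
Proof.
rewrite /tmul tlift_pure; last exact: balanced_mull.
by rewrite tlift_pure //; apply: balanced_mulr.
Qed.

Lemma tmulDl : left_distributive tmul +%R.
Proof. by move=> x y z; rewrite /tmul tliftD //; apply: balanced_mull. Qed.

Lemma tmulC : commutative tmul.
Proof.
move=> x y; rewrite /tmul /tlift exchange_big /=.
apply: eq_bigr => q _; apply: eq_bigr => p _.
by rewrite (mulrC q.1) (mulrC q.2).
Qed.

Lemma tmulDr : right_distributive tmul +%R.
Proof. by move=> x y z; rewrite tmulC tmulDl !(tmulC x). Qed.

Lemma tmul0 : left_zero 0 tmul.
Proof. by move=> x; rewrite /tmul tlift0 //; apply: balanced_mull. Qed.

Lemma tmulA : associative tmul.
Proof.
move=> x y z; elim/tensor_ind: x => [|a b x IHx]; first by rewrite !tmul0.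
rewrite !tmulDl IHx; congr (_ + _) => {x IHx}.
elim/tensor_ind: y => [|c d y IHy].
  by rewrite tmul0 ![tmul (pure a b) 0]tmulC !tmul0.
rewrite tmulDl !tmulDr tmulDl IHy; congr (_ + _) => {y IHy}.
elim/tensor_ind: z => [|e f z IHz]; first by rewrite ![tmul _ 0]tmulC !tmul0 tmulC tmul0.
by rewrite !tmulDr IHz !tmul_pure !mulrA.
Qed.

Lemma tmul1 : left_id tone tmul.
Proof.
move=> x; elim/tensor_ind: x => [|a b x IHx]; first by rewrite tmulC tmul0.
by rewrite tmulDr IHx tmul_pure !mul1r.
Qed.

Lemma tone_neq0 : tone != 0.
Proof.
have mb : balanced (fun a b : A => a * b).
  by split=> [a a' b|a b b'|r a b]; rewrite ?mulrDl ?mulrDr // mulrCA mulrA.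
apply/eqP => /(congr1 (tlift (fun a b : A => a * b))).
by rewrite tlift_pure // tlift0 // mulr1; apply/eqP/oner_neq0.
Qed.

HB.instance Definition _ :=
  GRing.Zmodule_isComNzRing.Build tensor tmulA tmulC tmul1 tmulDl tone_neq0.

Lemma pureM a b c d : pure a b * pure c d = pure (a * c) (b * d).
Proof. exact: tmul_pure. Qed.

Lemma pure1 : pure 1 1 = 1.
Proof. by []. Qed.

End Tensor.

Arguments tensor {k A} i.
Arguments pure {k A} i a b.

Definition sum_of_squares (T : pzRingType) (x : T) : Prop :=
  exists s : seq T, x = \sum_(y <- s) y ^+ 2.

(* Finite boolean combinations of polynomial inequalities in n variables. *)
Inductive safm (F : nzRingType) (n : nat) : Type :=
| SaGe0 of mpoly.mpoly n F
| SaNot of safm F n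
| SaAnd of safm F n & safm F n
| SaOr of safm F n & safm F n.

Fixpoint sa_set (F : realDomainType) (n : nat) (phi : safm F n) : set 'rV[F]_n :=
  match phi with
  | SaGe0 p => [set x | 0 <= mpoly.meval (x ord0) p]
  | SaNot phi => ~` sa_set phi
  | SaAnd phi psi => sa_set phi `&` sa_set psi
  | SaOr phi psi => sa_set phi `|` sa_set psi
  end.

Fixpoint sa_map (F S : nzRingType) (iota : F -> S) (n : nat) (phi : safm F n) :
    safm S n :=
  match phi with
  | SaGe0 p => SaGe0 (mpoly.map_mpoly iota p)
  | SaNot phi => SaNot (sa_map iota phi)
  | SaAnd phi psi => SaAnd (sa_map iota phi) (sa_map iota psi)
  | SaOr phi psi => SaOr (sa_map iota phi) (sa_map iota psi)
  end.

Definition semialgebraic (F : realDomainType) (n : nat) (M : set 'rV[F]_n) : Prop :=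
  exists phi : safm F n, M = sa_set phi.

(* The base field extension M_S.  For semialgebraic M over a real closed field
   the set sa_set (sa_map iota phi) is the same for every description phi of M,
   by the Tarski-Seidenberg transfer principle. *)
Definition base_ext (F S : realDomainType) (iota : {rmorphism F -> S}) (n : nat)
    (M : set 'rV[F]_n) : set 'rV[S]_n :=
  [set x | exists phi : safm F n, M = sa_set phi /\ sa_set (sa_map iota phi) x].

(* A polynomial c_0 + c_1 x_1 + ... + c_n x_n of degree at most 1 is given by
   its coefficient vector c in F^(n+1). *)
Definition lin_eval (F : nzRingType) (n : nat) (c : 'rV[F]_n.+1) (x : 'rV[F]_n) : F :=
  c ord0 ord0 + \sum_(j < n) c ord0 (lift ord0 j) * x ord0 j.

Definition nonneg_cone (F : realDomainType) (n : nat) (K : set 'rV[F]_n) :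
    set 'rV[F]_n.+1 :=
  [set c | forall x, K x -> 0 <= lin_eval c x].

Definition tensor_eval (F S : comNzRingType) (iota : {rmorphism F -> S}) (n : nat)
    (c : 'rV[S]_n.+1) (a : 'rV[S]_n) : tensor iota :=
  pure iota 1 (c ord0 ord0) + \sum_(j < n) pure iota (a ord0 j) (c ord0 (lift ord0 j)).

Definition psdmx (F : realDomainType) (d : nat) (M : 'M[F]_d) : Prop :=
  M^T = M /\ forall v : 'rV[F]_d, 0 <= (v *m M *m v^T) ord0 ord0.

Definition spectrahedron (F : realDomainType) (s : nat) (D : set 'rV[F]_s) : Prop :=
  exists (d : nat) (A0 : 'M[F]_d) (A : 'I_s -> 'M[F]_d),
    [/\ A0^T = A0, forall j, (A j)^T = A j &
        D = [set x | psdmx (A0 + \sum_(j < s) x ord0 j *: A j)]].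

Definition spectrahedral_shadow (F : realDomainType) (n : nat) (K : set 'rV[F]_n) :
    Prop :=
  exists (s : nat) (D : set 'rV[F]_s) (L : 'M[F]_(s, n)) (b : 'rV[F]_n),
    spectrahedron D /\ K = [set x *m L + b | x in D].

(* Main.v *)
Require Import Defs.
From HB Require Import structures.
From mathcomp Require Import all_boot all_order all_algebra generic_quotient.
From mathcomp Require Import boolp classical_sets reals topology normedtype convex.
From mathcomp Require Import derive interval_inference ring lra.
From mathcomp.multinomials Require mpoly.
Import (canonicals, coercions) mpoly.
From mathcomp.real_closed Require qe_rcf_th qe_rcf.
Set Implicit Arguments.
Unset Strict Implicit.
Unset Printing Implicit Defensive.

Import Order.TTheory GRing.Theory Num.Theory.
Import numFieldNormedType.Exports.

Local Open Scope classical_set_scope.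
Local Open Scope ring_scope.

(** Everything goes through certificates with parameters in the base field, called
    patterns.  A pattern consists of a matrix [L] and of symmetric matrices [M_l].
    A point [a] is primal for it when [(1, a) = e L] for some [e] such that the
    pencil [sum_l e_l M_l] is positive semidefinite; an affine function [f] is dual
    for it when some positive semidefinite [G] satisfies [(L f)_l = tr (M_l G)] for
    all [l].  Over any real closed extension, if [a] is primal and [f] is dual, then
    [f(a)] is the trace of the product of the pencil with [G], hence nonnegative;
    the same computation in the tensor product, with the pencil and [G] written as
    Gram matrices, makes the tensor evaluation of [f] at [a] a sum of squares
    ([pattern_tensor_eval]).  Conversely a sum of squares equal to the tensor
    evaluation produces such a pattern: the left factors that occur in the identity
    lie in a finite dimensional space over the base field, and [L] and the [M_l]
    are their coordinates in a basis of it ([sum_of_squares_pattern]).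

    If [K] is a nonempty spectrahedral shadow, one pattern serves all points of [K]
    and all affine functions nonnegative on [K] ([shadow_pattern]).  One homogenizes
    the linear matrix inequality, restricts it to the face spanned by a feasible
    matrix of maximal rank, so that the Slater condition holds, and obtains the
    dual certificates from the extension theorem of M. Riesz.  That the pattern
    serves all pairs is a first-order statement, so Tarski's transfer principle
    carries it to every real closed extension.

    If all tensor evaluations are sums of squares, every pair over every extension
    has its own pattern.  An ultrapower indexed by the finite lists of patterns
    shows that finitely many patterns suffice for the pairs over the base field
    ([finitely_many_patterns]).  By biduality, [K] is then the section at height one
    of a finite sum of finite intersections of primal cones, and such sums are
    linear images of spectrahedral cones ([finite_cover_shadow]).

    The transfer principle is obtained from a quantifier elimination procedure for
    a single real closed field, by proving that the formulas which it outputs do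
    not depend on the field of the constants. *)

(** * Quantifier elimination commutes with extension of the constants *)
Section QeNaturality.
Variables (F S : rcfType) (h : {rmorphism F -> S}).

Fixpoint term_map (t : qe_rcf.term F) : qe_rcf.term S :=
  match t with
  | qe_rcf.Var j => qe_rcf.Var S j
  | qe_rcf.Const c => qe_rcf.Const (h c)
  | qe_rcf.NatConst m => qe_rcf.NatConst S m
  | qe_rcf.Add t u => qe_rcf.Add (term_map t) (term_map u)
  | qe_rcf.Opp t => qe_rcf.Opp (term_map t)
  | qe_rcf.NatMul t m => qe_rcf.NatMul (term_map t) m
  | qe_rcf.Mul t u => qe_rcf.Mul (term_map t) (term_map u)
  | qe_rcf.Exp t m => qe_rcf.Exp (term_map t) m
  end.

Fixpoint form_map (f : qe_rcf.formula F) : qe_rcf.formula S :=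
  match f with
  | qe_rcf.Bool b => qe_rcf.Bool b
  | qe_rcf.Equal t u => qe_rcf.Equal (term_map t) (term_map u)
  | qe_rcf.Lt t u => qe_rcf.Lt (term_map t) (term_map u)
  | qe_rcf.Le t u => qe_rcf.Le (term_map t) (term_map u)
  | qe_rcf.And f g => qe_rcf.And (form_map f) (form_map g)
  | qe_rcf.Or f g => qe_rcf.Or (form_map f) (form_map g)
  | qe_rcf.Implies f g => qe_rcf.Implies (form_map f) (form_map g)
  | qe_rcf.Not f => qe_rcf.Not (form_map f)
  end.

Local Notation tm := term_map.
Local Notation fm := form_map.
Local Notation pm := (map term_map).
Local Notation psm := (map (map term_map)).

(** The elimination procedure is written in continuation-passing style and only
    builds formulas: every branching on the value of a term becomes a subformula.
    The lemmas below follow its structure and push [form_map] through it, the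
    continuations being assumed compatible in the same sense. *)
Lemma map_Size p k k' : (forall m, fm (k m) = k' m) ->
  fm (qe_rcf.Size p k) = qe_rcf.Size (pm p) k'.
Proof.
elim: p k k' => [|c p IHp] k k' kk' /=; first exact: kk'.
by apply: IHp => -[|m] /=; rewrite ?kk'.
Qed.

Lemma map_Isnull p k k' : (forall b, fm (k b) = k' b) ->
  fm (qe_rcf.Isnull p k) = qe_rcf.Isnull (pm p) k'.
Proof. by move=> kk'; apply: map_Size => m; apply: kk'. Qed.

Lemma map_LtSize p q k k' : (forall b, fm (k b) = k' b) ->
  fm (qe_rcf.LtSize p q k) = qe_rcf.LtSize (pm p) (pm q) k'.
Proof. by move=> kk'; do 2!apply: map_Size => ?; apply: kk'. Qed.

Lemma map_LeadCoef p k k' : (forall t, fm (k t) = k' (tm t)) ->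
  fm (qe_rcf.LeadCoef p k) = qe_rcf.LeadCoef (pm p) k'.
Proof.
elim: p k k' => [|c p IHp] k k' kk' /=; first by rewrite kk' /= rmorph0.
by apply: IHp => t /=; rewrite !kk'.
Qed.

Lemma map_AmulXn a m : pm (qe_rcf.AmulXn a m) = qe_rcf.AmulXn (tm a) m.
Proof. by elim: m => //= m ->; rewrite rmorph0. Qed.

Lemma map_AddPoly p q : pm (qe_rcf.AddPoly p q) = qe_rcf.AddPoly (pm p) (pm q).
Proof. by elim: p q => [|a p IHp] [|b q] //=; rewrite IHp. Qed.

Lemma map_ScalPoly c p : pm (qe_rcf.ScalPoly c p) = qe_rcf.ScalPoly (tm c) (pm p).
Proof. by rewrite /qe_rcf.ScalPoly -!map_comp. Qed.

Lemma map_MulPoly p q : pm (qe_rcf.MulPoly p q) = qe_rcf.MulPoly (pm p) (pm q).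
Proof. by elim: p => [|a p IHp] //=; rewrite map_AddPoly map_ScalPoly /= IHp. Qed.

Lemma map_ExpPoly p m : pm (qe_rcf.ExpPoly p m) = qe_rcf.ExpPoly (pm p) m.
Proof.
case: m => // m; rewrite /qe_rcf.ExpPoly !iteropS.
by elim: m => //= m IHm; rewrite map_MulPoly IHm.
Qed.

Lemma map_OppPoly p : pm (qe_rcf.OppPoly p) = qe_rcf.OppPoly (pm p).
Proof. by rewrite /qe_rcf.OppPoly map_ScalPoly /= rmorphN1. Qed.

Lemma map_NatMulPoly m p : pm (qe_rcf.NatMulPoly m p) = qe_rcf.NatMulPoly m (pm p).
Proof. exact: map_ScalPoly. Qed.

Lemma map_Deriv p : pm (qe_rcf.Deriv p) = qe_rcf.Deriv (pm p).
Proof. by elim: p => //= a p IHp; rewrite map_AddPoly /= IHp. Qed.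

Lemma map_Rediv_rec_loop q sq cq c qq r m k k' :
  (forall c qq r, fm (k (c, qq, r)) = k' (c, pm qq, pm r)) ->
  fm (qe_rcf.Rediv_rec_loop q sq cq c qq r m k) =
  qe_rcf.Rediv_rec_loop (pm q) sq (tm cq) c (pm qq) (pm r) m k'.
Proof.
elim: m c qq r k k' => [|m IHm] c qq r k k' kk' /=; apply: map_Size => sr;
  case: ifP => // _; apply: map_LeadCoef => t;
  rewrite ?kk' ?(IHm _ _ _ _ k') //;
  by rewrite !(map_AddPoly, map_MulPoly, map_AmulXn, map_OppPoly).
Qed.

Lemma map_Rediv p q k k' :
  (forall c qq r, fm (k (c, qq, r)) = k' (c, pm qq, pm r)) ->
  fm (qe_rcf.Rediv p q k) = qe_rcf.Rediv (pm p) (pm q) k'.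
Proof.
move=> kk'; apply: map_Isnull => -[]; first by rewrite kk' /= rmorph0.
do 2!apply: map_Size => ?; apply: map_LeadCoef => t.
by rewrite (map_Rediv_rec_loop _ _ _ _ _ _ _ kk') /= rmorph0.
Qed.

Lemma map_Rmod p q k k' : (forall r, fm (k r) = k' (pm r)) ->
  fm (qe_rcf.Rmod p q k) = qe_rcf.Rmod (pm p) (pm q) k'.
Proof. by move=> kk'; apply: map_Rediv => c qq r; apply: kk'. Qed.

Lemma map_Rscal p q k k' : (forall m, fm (k m) = k' m) ->
  fm (qe_rcf.Rscal p q k) = qe_rcf.Rscal (pm p) (pm q) k'.
Proof. by move=> kk'; apply: map_Rediv => c qq r; apply: kk'. Qed.

Lemma map_Rgcd_loop m p q k k' : (forall r, fm (k r) = k' (pm r)) ->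
  fm (qe_rcf.Rgcd_loop m p q k) = qe_rcf.Rgcd_loop m (pm p) (pm q) k'.
Proof.
move=> kk'; elim: m p q => [|m IHm] p q /=; apply: map_Rmod => r;
  apply: map_Isnull => -[] //; exact: kk'.
Qed.

Lemma map_Rgcd p q k k' : (forall r, fm (k r) = k' (pm r)) ->
  fm (qe_rcf.Rgcd p q k) = qe_rcf.Rgcd (pm p) (pm q) k'.
Proof.
move=> kk'; apply: map_LtSize => -[]; apply: map_Isnull => -[] //;
  apply: map_Size => m; exact: map_Rgcd_loop.
Qed.

Lemma map_BigRgcd ps k k' : (forall r, fm (k r) = k' (pm r)) ->
  fm (qe_rcf.BigRgcd ps k) = qe_rcf.BigRgcd (psm ps) k'.
Proof.
elim: ps k k' => [|p ps IHps] k k' kk' /=; first by rewrite kk' /= rmorph0.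
by apply: IHps => r; apply: map_Rgcd.
Qed.

Lemma map_Changes s k k' : (forall m, fm (k m) = k' m) ->
  fm (qe_rcf.Changes s k) = qe_rcf.Changes (pm s) k'.
Proof.
elim: s k k' => [|a s IHs] k k' kk' /=; first exact: kk'.
by apply: IHs => m /=; rewrite !kk'; case: (s).
Qed.

Lemma map_SeqPInfty ps k k' : (forall s, fm (k s) = k' (pm s)) ->
  fm (qe_rcf.SeqPInfty ps k) = qe_rcf.SeqPInfty (psm ps) k'.
Proof.
elim: ps k k' => [|p ps IHps] k k' kk' /=; first exact: kk'.
by apply: map_LeadCoef => t; apply: IHps => s; rewrite kk'.
Qed.

Lemma map_SeqMInfty ps k k' : (forall s, fm (k s) = k' (pm s)) ->
  fm (qe_rcf.SeqMInfty ps k) = qe_rcf.SeqMInfty (psm ps) k'.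
Proof.
elim: ps k k' => [|p ps IHps] k k' kk' /=; first exact: kk'.
apply: map_LeadCoef => t; apply: map_Size => m; apply: IHps => s.
by rewrite kk' /= rmorphN1.
Qed.

Lemma map_ChangesPoly ps k k' : (forall z, fm (k z) = k' z) ->
  fm (qe_rcf.ChangesPoly ps k) = qe_rcf.ChangesPoly (psm ps) k'.
Proof.
move=> kk'; apply: map_SeqMInfty => s; apply: map_SeqPInfty => s'.
by do 2!apply: map_Changes => ?; apply: kk'.
Qed.

Lemma map_NextMod p q k k' : (forall r, fm (k r) = k' (pm r)) ->
  fm (qe_rcf.NextMod p q k) = qe_rcf.NextMod (pm p) (pm q) k'.
Proof.
move=> kk'; apply: map_LeadCoef => t; apply: map_Rscal => m.
by apply: map_Rmod => r; rewrite kk' map_ScalPoly.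
Qed.

Lemma map_ModsAux p q m k k' : (forall s, fm (k s) = k' (psm s)) ->
  fm (qe_rcf.ModsAux p q m k) = qe_rcf.ModsAux (pm p) (pm q) m k'.
Proof.
elim: m p q k k' => [|m IHm] p q k k' kk' /=; first exact: kk'.
apply: map_Isnull => -[]; first exact: kk'.
by apply: map_NextMod => r; apply: IHm => s; apply: kk'.
Qed.

Lemma map_Mods p q k k' : (forall s, fm (k s) = k' (psm s)) ->
  fm (qe_rcf.Mods p q k) = qe_rcf.Mods (pm p) (pm q) k'.
Proof. by move=> kk'; do 2!apply: map_Size => ?; apply: map_ModsAux. Qed.

Lemma map_nth_nil sq j : pm (nth [::] sq j) = nth [::] (psm sq) j.
Proof. by elim: sq j => [|p sq IHsq] [|j] /=. Qed.

Lemma map_PolyComb sq sc :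
  pm (qe_rcf.PolyComb sq sc) = qe_rcf.PolyComb (psm sq) sc.
Proof.
rewrite /qe_rcf.PolyComb size_map.
elim: (iota _ _) => //= j s IHs; rewrite map_MulPoly IHs map_ExpPoly.
by rewrite map_nth_nil.
Qed.

Lemma map_Pcq sq j : pm (qe_rcf.Pcq sq j) = qe_rcf.Pcq (psm sq) j.
Proof.
rewrite /qe_rcf.Pcq size_map.
elim: (qe_rcf_th.sg_tab _) j => [|s l IHl] [|j] //=; exact: map_PolyComb.
Qed.

Lemma map_TaqR p q k k' : (forall z, fm (k z) = k' z) ->
  fm (qe_rcf.TaqR p q k) = qe_rcf.TaqR (pm p) (pm q) k'.
Proof.
move=> kk'; rewrite /qe_rcf.TaqR -map_Deriv -map_MulPoly.
by apply: map_Mods => s; apply: map_ChangesPoly.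
Qed.

Lemma map_TaqsR p sq j k k' : (forall t, fm (k t) = k' (tm t)) ->
  fm (qe_rcf.TaqsR p sq j k) = qe_rcf.TaqsR (pm p) (psm sq) j k'.
Proof.
move=> kk'; rewrite /qe_rcf.TaqsR -map_Pcq; apply: map_TaqR => z.
by rewrite kk' /= rmorph_int.
Qed.

Lemma map_BoundingPoly sq :
  pm (qe_rcf.BoundingPoly sq) = qe_rcf.BoundingPoly (psm sq).
Proof.
rewrite /qe_rcf.BoundingPoly map_Deriv; congr qe_rcf.Deriv.
by elim: sq => //= p sq IHsq; rewrite map_MulPoly IHsq.
Qed.

(** These constants are entries of inverses of integer matrices, hence the same
    rational numbers in every field. *)
Lemma map_Coefs m j : tm (qe_rcf.Coefs F m j) = qe_rcf.Coefs S m j.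
Proof.
case: m => [|[|m]] /=; first by rewrite rmorph_nat.
  congr qe_rcf.Const; case: j => [|[|[|j]]] /=;
    by rewrite ?nth_default // ?fmorphV ?rmorph_nat ?rmorph0.
congr qe_rcf.Const; rewrite /qe_rcf_th.coefs.
set E := map _ _; set E' := map _ _.
have -> : E' = map h E.
  rewrite -map_comp; apply: eq_map => r /=.
  have mapE a b (A : 'M[F]_(a, b)) x y : h (A x y) = map_mx h A x y.
    by rewrite mxE.
  rewrite mapE map_castmx map_invmx -map_mx_comp.
  by congr (castmx _ (invmx _) _ _); apply/matrixP => a b; rewrite !mxE /= rmorph_int.
by elim: (E) j => [|x s IHs] [|j] //=; rewrite rmorph0.
Qed.

Lemma map_CcountWeak p sq k k' : (forall t, fm (k t) = k' (tm t)) ->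
  fm (qe_rcf.CcountWeak p sq k) = qe_rcf.CcountWeak (pm p) (psm sq) k'.
Proof.
rewrite /qe_rcf.CcountWeak size_map; move: (3 ^ _)%N => m.
rewrite -[qe_rcf.NatConst S 0]/(tm (qe_rcf.NatConst F 0)).
elim: m (qe_rcf.NatConst F 0) k k' => [|m IHm] t k k' kk' /=; first exact: kk'.
apply: map_TaqsR => u; rewrite (IHm _ _ k') //.
by rewrite -map_Coefs.
Qed.

Lemma map_CcountGt0 sp sq :
  fm (qe_rcf.CcountGt0 sp sq) = qe_rcf.CcountGt0 (psm sp) (psm sq).
Proof.
apply: map_BigRgcd => r; apply: map_Isnull => -[] /=; last first.
  by apply: map_CcountWeak => t.
rewrite -map_BoundingPoly; apply: map_CcountWeak => t /=.
congr (qe_rcf.Or _ (qe_rcf.Or _ _)).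
  elim: sq => //= p sq ->; congr (qe_rcf.And _ _).
  by apply: map_LeadCoef.
elim: sq => //= p sq ->; congr (qe_rcf.And _ _).
by apply: map_Size => m; apply: map_LeadCoef.
Qed.

Lemma map_abstrX j t : pm (qe_rcf.abstrX j t) = qe_rcf.abstrX j (tm t).
Proof.
elim: t => //= [m|t IHt u IHu|t IHt|t IHt m|t IHt u IHu|t IHt m].
- by case: ifP.
- by rewrite map_AddPoly IHt IHu.
- by rewrite map_OppPoly IHt.
- by rewrite map_NatMulPoly IHt.
- by rewrite map_MulPoly IHt IHu.
- by rewrite map_ExpPoly IHt.
Qed.
End QeNaturality.

(** * Uniformly definable families and the transfer principle *)
Section Elimination.
Variable F : rcfType.
Implicit Types (f : qe_rcf.formula F) (t : qe_rcf.term F).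

Definition clause_holds (S : rcfType) (h : {rmorphism F -> S}) (e : seq S)
    (c : seq (qe_rcf.term F) * seq (qe_rcf.term F)) : bool :=
  all (fun t => qe_rcf.eval e (term_map h t) == 0) c.1 &&
  all (fun t => 0 < qe_rcf.eval e (term_map h t)) c.2.

Let dnf (Q : forall S : rcfType, {rmorphism F -> S} -> seq S -> bool) : Prop :=
  exists d, forall (S : rcfType) (h : {rmorphism F -> S}) (e : seq S),
    Q S h e = has (clause_holds h e) d.

Let dnf_or Q1 Q2 : dnf Q1 -> dnf Q2 -> dnf (fun S h e => Q1 S h e || Q2 S h e).
Proof.
by case=> d1 D1 [d2 D2]; exists (d1 ++ d2) => S h e; rewrite has_cat D1 D2.
Qed.

Let dnf_and Q1 Q2 : dnf Q1 -> dnf Q2 -> dnf (fun S h e => Q1 S h e && Q2 S h e).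
Proof.
case=> d1 D1 [d2 D2].
exists [seq (c.1 ++ c'.1, c.2 ++ c'.2) | c <- d1, c' <- d2] => S h e.
rewrite D1 D2; elim: d1 {D1} => [|c d1 IHd1] //=.
rewrite has_cat andb_orl IHd1; congr (_ || _).
rewrite has_map; elim: d2 {D2 IHd1} => [|c' d2 IHd2] /=; first by rewrite andbF.
rewrite andb_orr IHd2; congr (_ || _).
by rewrite /clause_holds !all_cat; case: (all _ c.1); case: (all _ c'.1);
  case: (all _ c.2); case: (all _ c'.2).
Qed.

Let dnf_ext Q1 Q2 : (forall S h e, Q1 S h e = Q2 S h e) -> dnf Q1 -> dnf Q2.
Proof. by move=> E [d D]; exists d => S h e; rewrite -E D. Qed.

Let dnf_eq t u : dnf (fun S h e =>
  qe_rcf.eval e (term_map h t) == qe_rcf.eval e (term_map h u)).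
Proof.
exists [:: ([:: qe_rcf.Add t (qe_rcf.Opp u)], [::])] => S h e.
by rewrite /clause_holds /= subr_eq0 !andbT orbF.
Qed.

Let dnf_lt t u : dnf (fun S h e =>
  qe_rcf.eval e (term_map h t) < qe_rcf.eval e (term_map h u)).
Proof.
exists [:: ([::], [:: qe_rcf.Add u (qe_rcf.Opp t)])] => S h e.
by rewrite /clause_holds /= subr_gt0 !andbT orbF.
Qed.

(** Negations are pushed to the atoms, so the induction carries both polarities. *)
Lemma formula_dnf f :
  dnf (fun S h e => qe_rcf.qf_eval e (form_map h f)) /\
  dnf (fun S h e => ~~ qe_rcf.qf_eval e (form_map h f)).
Proof.
elim: f => /= [b|t u|t u|t u|f [f1 f2] g [g1 g2]|f [f1 f2] g [g1 g2]
  |f [f1 f2] g [g1 g2]|f [f1 f2]].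
- by split; [exists (if b then [:: ([::], [::])] else [::])
    | exists (if b then [::] else [:: ([::], [::])])] => S h e; case: b.
- split; first exact: dnf_eq.
  apply: dnf_ext (dnf_or (dnf_lt t u) (dnf_lt u t)) => S h e /=.
  by rewrite neq_lt.
- split; first exact: dnf_lt.
  apply: dnf_ext (dnf_or (dnf_lt u t) (dnf_eq u t)) => S h e /=.
  by rewrite -leNgt le_eqVlt orbC.
- split; last by apply: dnf_ext (dnf_lt u t) => S h e; rewrite ltNge.
  apply: dnf_ext (dnf_or (dnf_lt t u) (dnf_eq t u)) => S h e /=.
  by rewrite le_eqVlt orbC.
- split; first exact: dnf_and.
  by apply: dnf_ext (dnf_or f2 g2) => S h e; rewrite negb_and.
- split; first exact: dnf_or.
  by apply: dnf_ext (dnf_and f2 g2) => S h e; rewrite negb_or.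
- split; first by apply: dnf_ext (dnf_or f2 g1) => S h e; rewrite implybE.
  by apply: dnf_ext (dnf_and f1 g2) => S h e; rewrite negb_imply.
- by split=> //; apply: dnf_ext f1 => S h e; rewrite negbK.
Qed.

(** One existential quantifier is eliminated by a formula that works for all
    extensions at once; this uniformity is what transfer rests on. *)
Lemma formula_exists f (j : nat) : exists g,
  forall (S : rcfType) (h : {rmorphism F -> S}) (e : seq S),
  qe_rcf.qf_eval e (form_map h g) <->
  exists x, qe_rcf.qf_eval (set_nth 0 e j x) (form_map h f).
Proof.
have [[d Ed] _] := formula_dnf f.
suff [g Eg] : exists g, forall (S : rcfType) (h : {rmorphism F -> S}) (e : seq S),
    qe_rcf.qf_eval e (form_map h g) <->
    exists x, has (clause_holds h (set_nth 0 e j x)) d.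
  exists g => S h e; rewrite Eg.
  by split=> -[x Hx]; exists x; rewrite ?Ed // -Ed.
elim: d {Ed} => [|c d [g Eg]].
  by exists (qe_rcf.Bool false) => S h e /=; split => // -[].
pose sp := map (qe_rcf.abstrX j) c.1; pose sq := map (qe_rcf.abstrX j) c.2.
exists (qe_rcf.Or (qe_rcf.CcountGt0 sp sq) g) => S h e /=.
rewrite map_CcountGt0 qe_rcf.eval_CcountGt0.
set b := qe_rcf_th.ccount_gt0 _ _.
suff Eb : b <-> exists x, clause_holds h (set_nth 0 e j x) c.
  split=> [/orP[/Eb|/Eg] [x Hx]|[x /orP[Hx|Hx]]].
  - by exists x; rewrite Hx.
  - by exists x; rewrite Hx orbT.
  - by apply/orP; left; apply/Eb; exists x.
  - by apply/orP; right; apply/Eg; exists x.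
have E x : clause_holds h (set_nth 0 e j x) c =
    \big[andb/true]_(p <- map (qe_rcf.eval_poly e) (map (map (term_map h)) sp)) (p.[x] == 0)
    && \big[andb/true]_(q <- map (qe_rcf.eval_poly e) (map (map (term_map h)) sq)) (0 < q.[x]).
  rewrite !big_all /clause_holds /sp /sq -!map_comp !all_map.
  by congr (_ && _); apply: eq_all => t /=; rewrite map_abstrX qe_rcf.abstrXP.
split=> [/qe_rcf_th.ccount_gt0P[x Hx]|[x Hx]]; first by exists x; rewrite E.
by apply/qe_rcf_th.ccount_gt0P; exists x; rewrite -E.
Qed.

End Elimination.

Section Definable.
Variable F : rcfType.

(** Families range over all extensions at once so that [definable] can ask for one
    formula over [F] that serves every extension. *)
Definition set_family n := forall S : rcfType, {rmorphism F -> S} -> 'rV[S]_n -> Prop.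
Definition function_family n := forall S : rcfType, {rmorphism F -> S} -> 'rV[S]_n -> S.

Definition definable n (P : set_family n) : Prop :=
  exists phi : safm F n, forall (S : rcfType) (h : {rmorphism F -> S}) x,
    sa_set (sa_map h phi) x <-> P S h x.

Definition polyfun n (T : function_family n) : Prop :=
  exists p : mpoly.mpoly n F, forall (S : rcfType) (h : {rmorphism F -> S}) x,
    T S h x = mpoly.meval (x ord0) (mpoly.map_mpoly h p).

Lemma polyfun_const n c : @polyfun n (fun S h x => h c).
Proof.
by exists (mpoly.mpolyC n c) => S h x; rewrite mpoly.map_mpolyC mpoly.mevalC.
Qed.

Lemma polyfun_coord n (j : 'I_n) : @polyfun n (fun S h x => x ord0 j).
Proof.
by exists (mpoly.mpolyX _ (mpoly.mnm1 j)) => S h x; rewrite mpoly.map_mpolyX mpoly.mevalXU.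
Qed.

Lemma polyfun_add n T U : @polyfun n T -> polyfun U ->
  @polyfun n (fun S h x => T S h x + U S h x).
Proof.
case=> p Hp [q Hq]; exists (p + q) => S h x.
by rewrite rmorphD mpoly.mevalD Hp Hq.
Qed.

Lemma polyfun_mul n T U : @polyfun n T -> polyfun U ->
  @polyfun n (fun S h x => T S h x * U S h x).
Proof.
case=> p Hp [q Hq]; exists (p * q) => S h x.
by rewrite rmorphM mpoly.mevalM Hp Hq.
Qed.

Lemma polyfun_opp n T : @polyfun n T -> @polyfun n (fun S h x => - T S h x).
Proof. by case=> p Hp; exists (- p) => S h x; rewrite rmorphN mpoly.mevalN Hp. Qed.

Lemma polyfun_ext n T U : (forall S h x, T S h x = U S h x) ->
  @polyfun n T -> @polyfun n U.
Proof. by move=> TU [p Hp]; exists p => S h x; rewrite -TU. Qed.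

Lemma polyfun_0 n : @polyfun n (fun S h x => 0).
Proof.
by apply: polyfun_ext (polyfun_const n 0) => S h x; rewrite rmorph0.
Qed.

Lemma polyfun_1 n : @polyfun n (fun S h x => 1).
Proof.
by apply: polyfun_ext (polyfun_const n 1) => S h x; rewrite rmorph1.
Qed.

Lemma polyfun_sum n (I : Type) (r : seq I) (T : I -> function_family n) :
  (forall j, polyfun (T j)) ->
  @polyfun n (fun S h x => \sum_(j <- r) T j S h x).
Proof.
move=> HT; elim: r => [|j r IHr].
  by apply: polyfun_ext (polyfun_0 n) => S h x; rewrite big_nil.
by apply: polyfun_ext (polyfun_add (HT j) IHr) => S h x; rewrite big_cons.
Qed.

Lemma polyfun_exp n T m : @polyfun n T -> @polyfun n (fun S h x => T S h x ^+ m).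
Proof.
by case=> p Hp; exists (p ^+ m) => S h x; rewrite rmorphXn rmorphXn /= Hp.
Qed.

Lemma polyfun_prod n (I : Type) (r : seq I) (T : I -> function_family n) :
  (forall j, polyfun (T j)) ->
  @polyfun n (fun S h x => \prod_(j <- r) T j S h x).
Proof.
move=> HT; elim: r => [|j r IHr].
  by apply: polyfun_ext (polyfun_1 n) => S h x; rewrite big_nil.
by apply: polyfun_ext (polyfun_mul (HT j) IHr) => S h x; rewrite big_cons.
Qed.

Lemma polyfun_subst n m (p : mpoly.mpoly n F)
    (T : forall S : rcfType, {rmorphism F -> S} -> 'rV[S]_m -> 'rV[S]_n) :
  (forall j, polyfun (fun S h x => T S h x ord0 j)) ->
  polyfun (fun S h x => mpoly.meval (T S h x ord0) (mpoly.map_mpoly h p)).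
Proof.
move=> HT; elim/mpoly.mpolyind: p => [|c mm p _ _ IHp].
  by apply: polyfun_ext (polyfun_0 m) => S h x; rewrite rmorph0 mpoly.meval0.
have Hm : polyfun (fun S h x => h c * \prod_(j < n) T S h x ord0 j ^+ mm j).
  apply: polyfun_mul (polyfun_const m c) _.
  by apply: polyfun_prod => j; apply/polyfun_exp/HT.
apply: polyfun_ext (polyfun_add Hm IHp) => S h x.
rewrite rmorphD /= mpoly.mevalD; congr (_ + _).
by rewrite mpoly.map_mpolyZ mpoly.map_mpolyX mpoly.mevalZ mpoly.mevalX.
Qed.

Lemma definable_ext n P Q : (forall S h x, P S h x <-> Q S h x) ->
  @definable n P -> definable Q.
Proof. by move=> PQ [phi Hphi]; exists phi => S h x; rewrite -PQ. Qed.

Lemma definable_sa n (phi : safm F n) :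
  definable (fun S h x => sa_set (sa_map h phi) x).
Proof. by exists phi. Qed.

Lemma definable_ge0 n T : polyfun T ->
  @definable n (fun S h x => 0 <= T S h x).
Proof. by case=> p Hp; exists (SaGe0 p) => S h x /=; rewrite Hp. Qed.

Lemma definable_not n P : @definable n P -> @definable n (fun S h x => ~ P S h x).
Proof. by case=> phi Hphi; exists (SaNot phi) => S h x /=; rewrite -Hphi. Qed.

Lemma definable_and n P Q : @definable n P -> definable Q ->
  @definable n (fun S h x => P S h x /\ Q S h x).
Proof.
case=> phi Hphi [psi Hpsi]; exists (SaAnd phi psi) => S h x /=.
by rewrite -Hphi -Hpsi.
Qed.

Lemma definable_or n P Q : @definable n P -> definable Q ->
  @definable n (fun S h x => P S h x \/ Q S h x).
Proof.
case=> phi Hphi [psi Hpsi]; exists (SaOr phi psi) => S h x /=.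
by rewrite -Hphi -Hpsi.
Qed.

Lemma definable_imp n P Q : @definable n P -> definable Q ->
  @definable n (fun S h x => P S h x -> Q S h x).
Proof.
move=> HP HQ; apply: definable_ext (definable_or (definable_not HP) HQ) => S h x.
split=> [[] //|PQ]; have [/PQ|] := pselect (P S h x); by [right|left].
Qed.

Lemma definable_subst n m P
    (T : forall S : rcfType, {rmorphism F -> S} -> 'rV[S]_m -> 'rV[S]_n) :
  (forall j, polyfun (fun S h x => T S h x ord0 j)) ->
  definable P -> definable (fun S h x => P S h (T S h x)).
Proof.
move=> HT [phi Hphi].
apply: definable_ext (_ : definable (fun S h x => sa_set (sa_map h phi) (T S h x))).
  by move=> S h x; apply: Hphi.
elim: phi {P Hphi} => [p|phi IH|phi IH psi IH'|phi IH psi IH'] /=.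
- by apply: definable_ge0; apply: polyfun_subst.
- exact: definable_not.
- exact: definable_and.
- exact: definable_or.
Qed.

Lemma definable_eq n T U : polyfun T -> polyfun U ->
  @definable n (fun S h x => T S h x = U S h x).
Proof.
move=> HT HU.
have H1 := definable_ge0 (polyfun_add HT (polyfun_opp HU)).
have H2 := definable_ge0 (polyfun_add HU (polyfun_opp HT)).
apply: definable_ext (definable_and H1 H2) => S h x.
rewrite !subr_ge0; split=> [[l1 l2]|->]; last by rewrite lexx.
by apply/eqP; rewrite eq_le l1 l2.
Qed.

Lemma definable_true n : @definable n (fun S h x => True).
Proof.
apply: definable_ext (definable_ge0 (polyfun_0 n)) => S h x.
by rewrite lexx.
Qed.

Lemma definable_all n (I : finType) (P : I -> set_family n) :
  (forall j, definable (P j)) -> definable (fun S h x => forall j, P j S h x).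
Proof.
move=> HP; suff H (r : seq I) : @definable n (fun S h x => forall j, j \in r -> P j S h x).
  apply: definable_ext (H (enum I)) => S h x.
  by split=> Hr j *; apply: Hr; rewrite // mem_enum.
elim: r => [|j r IHr]; first by apply: definable_ext (definable_true n) => S h x; split.
apply: definable_ext (definable_and (HP j) IHr) => S h x; split.
  by case=> Hj Hr l; rewrite inE => /predU1P[->|/Hr].
by move=> H; split=> [|l lr]; apply: H; rewrite inE ?eqxx ?lr ?orbT.
Qed.

Let row_env (S : rcfType) n (x : 'rV[S]_n) : seq S :=
  mkseq (fun j => \sum_(l < n | val l == j) x ord0 l) n.

Let nth_row_env (S : rcfType) n (x : 'rV[S]_n) (j : 'I_n) : (row_env x)`_j = x ord0 j.
Proof.
rewrite nth_mkseq //; rewrite (bigD1 j) //= big1 ?addr0 // => l /andP[/eqP lj].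
by case/eqP; apply: val_inj.
Qed.

Lemma polyfun_formula n (T : function_family n) : polyfun T ->
  exists t : qe_rcf.term F, forall (S : rcfType) (h : {rmorphism F -> S}) x,
    T S h x = qe_rcf.eval (row_env x) (term_map h t).
Proof.
case=> p Hp.
suff [t Ht] : exists t, forall (S : rcfType) (h : {rmorphism F -> S}) (x : 'rV_n),
    mpoly.meval (x ord0) (mpoly.map_mpoly h p) = qe_rcf.eval (row_env x) (term_map h t).
  by exists t => S h x; rewrite Hp Ht.
elim/mpoly.mpolyind: p {T Hp} => [|c m p _ _ [t Ht]].
  by exists (qe_rcf.NatConst _ 0) => S h x /=; rewrite rmorph0 mpoly.meval0.
suff [u Hu] : exists u, forall (S : rcfType) (h : {rmorphism F -> S}) (x : 'rV_n),
    \prod_(j < n) x ord0 j ^+ m j = qe_rcf.eval (row_env x) (term_map h u).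
  exists (qe_rcf.Add (qe_rcf.Mul (qe_rcf.Const c) u) t) => S h x /=.
  rewrite rmorphD /= mpoly.mevalD Ht -Hu.
  by rewrite mpoly.map_mpolyZ mpoly.map_mpolyX mpoly.mevalZ mpoly.mevalX.
have [u Hu] : exists u, forall (S : rcfType) (h : {rmorphism F -> S}) (x : 'rV_n),
    \prod_(j <- enum 'I_n) x ord0 j ^+ m j = qe_rcf.eval (row_env x) (term_map h u).
  elim: (enum _) => [|j r [u Hu]].
    by exists (qe_rcf.NatConst _ 1) => S h x /=; rewrite big_nil.
  exists (qe_rcf.Mul (qe_rcf.Exp (qe_rcf.Var _ j) (m j)) u) => S h x /=.
  by rewrite big_cons (Hu _ h) nth_row_env.
by exists u => S h x; rewrite -Hu big_enum.
Qed.

Lemma definable_formula n (P : set_family n) : definable P ->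
  exists f : qe_rcf.formula F, forall (S : rcfType) (h : {rmorphism F -> S}) x,
    qe_rcf.qf_eval (row_env x) (form_map h f) <-> P S h x.
Proof.
case=> phi Hphi.
suff [f Hf] : exists f, forall (S : rcfType) (h : {rmorphism F -> S}) (x : 'rV_n),
    qe_rcf.qf_eval (row_env x) (form_map h f) <-> sa_set (sa_map h phi) x.
  by exists f => S h x; rewrite Hf.
elim: phi {P Hphi} => [p|phi [f Hf]|phi [f Hf] psi [g Hg]|phi [f Hf] psi [g Hg]] /=.
- have [|t Ht] := @polyfun_formula n
    (fun S h x => mpoly.meval (x ord0) (mpoly.map_mpoly h p)); first by exists p.
  by exists (qe_rcf.Le (qe_rcf.NatConst _ 0) t) => S h x /=; rewrite Ht.
- exists (qe_rcf.Not f) => S h x /=; rewrite -Hf; by split=> /negP.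
- exists (qe_rcf.And f g) => S h x /=; rewrite -Hf -Hg; by split=> /andP.
- exists (qe_rcf.Or f g) => S h x /=; rewrite -Hf -Hg; by split=> /orP.
Qed.

Lemma formula_definable n (f : qe_rcf.formula F) :
  definable (fun (S : rcfType) h (x : 'rV[S]_n) => qe_rcf.qf_eval (row_env x) (form_map h f)).
Proof.
have Ht t : polyfun (fun (S : rcfType) h (x : 'rV[S]_n) =>
    qe_rcf.eval (row_env x) (term_map h t)).
  elim: t => [j|c|m|t Ht u Hu|t Ht|t Ht m|t Ht u Hu|t Ht m] /=.
  - have [lt_jn|le_nj] := ltnP j n; last first.
      apply: polyfun_ext (polyfun_0 n) => S h x.
      by rewrite nth_default // size_mkseq.
    apply: polyfun_ext (polyfun_coord (Ordinal lt_jn)) => S h x.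
    by rewrite -nth_row_env.
  - exact: polyfun_const.
  - apply: polyfun_ext (polyfun_const n m%:R) => S h x.
    by rewrite rmorph_nat.
  - exact: polyfun_add.
  - exact: polyfun_opp.
  - apply: polyfun_ext (polyfun_mul Ht (polyfun_const n m%:R)) => S h x.
    by rewrite rmorph_nat mulr_natr.
  - exact: polyfun_mul.
  - exact: polyfun_exp.
elim: f => [b|t u|t u|t u|f Hf g Hg|f Hf g Hg|f Hf g Hg|f Hf] /=.
- have H1 := definable_true n; case: b; first exact: definable_ext H1.
  by apply: definable_ext (definable_not H1).
- by apply: definable_ext (definable_eq (Ht t) (Ht u)) => S h x; split=> /eqP.
- have := definable_not (definable_ge0 (polyfun_add (Ht t) (polyfun_opp (Ht u)))).
  apply: definable_ext => S h x; rewrite subr_ge0 ltNge; by split=> /negP.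
- have := definable_ge0 (polyfun_add (Ht u) (polyfun_opp (Ht t))).
  by apply: definable_ext => S h x; rewrite subr_ge0.
- by apply: definable_ext (definable_and Hf Hg) => S h x; split=> /andP.
- by apply: definable_ext (definable_or Hf Hg) => S h x; split=> /orP.
- by apply: definable_ext (definable_imp Hf Hg) => S h x; split=> /implyP.
- by apply: definable_ext (definable_not Hf) => S h x; split=> /negP.
Qed.

(** The row environment lists the coordinates of [x], so that adding a coordinate to
    [x] updates the environment at position [n]. *)
Lemma definable_exists1 n (P : set_family (n + 1)) : definable P ->
  definable (fun S h x => exists y : 'rV_1, P S h (row_mx x y)).
Proof.
move=> /definable_formula[f Hf]; have [g Hg] := formula_exists f n.
apply: definable_ext (formula_definable n g) => S h x; rewrite Hg.
have E (y : S) : set_nth 0 (row_env x) n y = row_env (row_mx x (const_mx y : 'rV_1)).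
  apply: (@eq_from_nth _ 0); first by rewrite size_set_nth !size_mkseq addn1 maxnC /maxn ltnSn.
  rewrite size_set_nth !size_mkseq maxnC /maxn ltnSn => j lt_j.
  have lt_j' : (j < n + 1)%N by rewrite addn1.
  rewrite nth_set_nth /= -[j in RHS]/(val (Ordinal lt_j')) nth_row_env.
  have -> : Ordinal lt_j' = unsplit (split (Ordinal lt_j')) by rewrite splitK.
  case: splitP => l /= ->.
    by rewrite row_mxEl nth_row_env ltn_eqF.
  by rewrite row_mxEr mxE [l]ord1 addn0 eqxx.
split=> [[y Hy]|[y Hy]]; first by exists (const_mx y); apply/Hf; rewrite -E.
exists (y ord0 ord0); rewrite E; apply/Hf; congr (P _ _ (row_mx _ _)): Hy.
by apply/matrixP => a b; rewrite mxE !ord1.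
Qed.

Lemma definable_exists k n (P : set_family (n + k)) : definable P ->
  definable (fun S h x => exists y : 'rV_k, P S h (row_mx x y)).
Proof.
elim: k n P => [|k IHk] n P HP.
  have := @definable_subst _ n P (fun S h x => row_mx x 0).
  move=> /(_ _ HP) H; apply: definable_ext (H _) => [S h x|j].
    split=> [Hx|[y Hy]]; first by exists 0.
    by rewrite [0](_ : _ = y) //; apply/matrixP => a [].
  case: (split_ordP j) => l ->; last by case: l.
  by apply: polyfun_ext (polyfun_coord l) => S h x; rewrite row_mxEl.
(* The first of the quantified variables is moved to the block of parameters. *)
pose T (S : rcfType) (h : {rmorphism F -> S}) (z : 'rV[S]_((n + 1) + k)) : 'rV[S]_(n + k.+1) :=
  row_mx (lsubmx (lsubmx z)) (row_mx (rsubmx (lsubmx z)) (rsubmx z) : 'rV_(1 + k)).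
have HT j : polyfun (fun S h x => T S h x ord0 j).
  case: (split_ordP j) => l ->; first by
    apply: polyfun_ext (polyfun_coord (lshift k (lshift 1 l))) => S h x;
    rewrite row_mxEl !mxE.
  have [l' El] : exists l' : 'I_(1 + k), l' = l by exists l.
  rewrite -El; case: (split_ordP l') => l'' ->.
    apply: polyfun_ext (polyfun_coord (lshift k (rshift n l''))) => S h x.
    rewrite /T (row_mxEr (lsubmx (lsubmx x))).
    by apply: (etrans _ (esym (row_mxEl _ _ _ _))); rewrite !mxE.
  apply: polyfun_ext (polyfun_coord (rshift (n + 1) l'')) => S h x.
  rewrite /T (row_mxEr (lsubmx (lsubmx x))).
  by apply: (etrans _ (esym (row_mxEr _ _ _ _))); rewrite mxE.
have := definable_exists1 (IHk _ _ (definable_subst HT HP)).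
apply: definable_ext => S h x; split.
  case=> y1 [y2]; rewrite /T !row_mxKl !row_mxKr => Hy.
  by exists (row_mx y1 y2 : 'rV_(1 + k)).
case=> y Hy; exists (lsubmx (y : 'rV_(1 + k))), (rsubmx (y : 'rV_(1 + k))).
by rewrite /T !row_mxKl !row_mxKr hsubmxK.
Qed.

Lemma definable_forall k n (P : set_family (n + k)) : definable P ->
  definable (fun S h x => forall y : 'rV_k, P S h (row_mx x y)).
Proof.
move=> /definable_not/definable_exists/definable_not.
apply: definable_ext => S h x; split=> [H y|H [y]]; last exact.
by apply/notP => nP; apply: H; exists y.
Qed.

(** In a real closed field the nonnegative elements are the squares. *)
Lemma rmorph_rcf_ge0 (S : rcfType) (h : {rmorphism F -> S}) x : (0 <= h x) = (0 <= x).
Proof.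
have ge0 y : 0 <= y -> 0 <= h y.
  by move=> y0; rewrite -(sqr_sqrtr y0) rmorphXn sqr_ge0.
have [/ge0 //|x_lt0] := leP 0 x.
apply/negbTE; rewrite -ltNge lt_neqAle fmorph_eq0 (ltr0_neq0 x_lt0) /=.
by rewrite -oppr_ge0 -rmorphN ge0 // oppr_ge0 ltW.
Qed.

Lemma sa_set_map (S : rcfType) (h : {rmorphism F -> S}) n (phi : safm F n) x :
  sa_set (sa_map h phi) (map_mx h x) <-> sa_set phi x.
Proof.
elim: phi => [p|phi IH|phi IH psi IH'|phi IH psi IH'] /=; rewrite ?IH ?IH' //.
suff -> : mpoly.meval (map_mx h x ord0) (mpoly.map_mpoly h p) =
    h (mpoly.meval (x ord0) p) by rewrite rmorph_rcf_ge0.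
elim/mpoly.mpolyind: p => [|c m p _ _ IHp]; first by rewrite rmorph0 !mpoly.meval0 rmorph0.
rewrite rmorphD /= !mpoly.mevalD rmorphD /= IHp; congr (_ + _).
rewrite mpoly.map_mpolyZ mpoly.map_mpolyX !mpoly.mevalZ !mpoly.mevalX rmorphM rmorph_prod.
by congr (_ * _); apply: eq_bigr => j _; rewrite mxE rmorphXn.
Qed.

Lemma definable_map n (P : set_family n) : definable P ->
  forall (S : rcfType) (h : {rmorphism F -> S}) x,
    P S h (map_mx h x) <-> P F idfun x.
Proof.
case=> phi Hphi S h x; rewrite -!Hphi sa_set_map.
by have := sa_set_map idfun phi x; rewrite map_mx_id // => ->.
Qed.

(** The Tarski transfer principle: the universal closure of a definable family is a
    sentence, equivalent to a formula in zero variables over [F]. *)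
Lemma transfer n (P : set_family n) : definable P -> (forall x, P F idfun x) ->
  forall (S : rcfType) (h : {rmorphism F -> S}) x, P S h x.
Proof.
move=> HP PF S h x.
pose Q : set_family (0 + n) := fun S h x => P S h (rsubmx x).
have HQ : definable Q.
  apply: definable_subst HP => j.
  by apply: polyfun_ext (polyfun_coord (rshift 0 j)) => S' h' x'; rewrite mxE.
have := definable_map (definable_forall HQ) h (0 : 'rV_0).
rewrite /Q => -[_ /(_ _ x)]; rewrite row_mxKr; apply.
by move=> y; rewrite row_mxKr.
Qed.

Lemma sa_set_idfun n (phi : safm F n) x : sa_set (sa_map idfun phi) x <-> sa_set phi x.
Proof. by rewrite -(sa_set_map idfun phi x) map_mx_id. Qed.

(** The base field extension of a set can be computed from any of its descriptions,
    because the equivalence of two descriptions transfers. *)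
Lemma base_extE (S : rcfType) (h : {rmorphism F -> S}) n (phi : safm F n) x :
  base_ext h (sa_set phi) x <-> sa_set (sa_map h phi) x.
Proof.
split=> [[psi [Epsi]]|Hx]; last by exists phi.
move: x; apply: (@transfer n (fun S h x => sa_set (sa_map h psi) x -> sa_set (sa_map h phi) x)).
  by apply: definable_imp; apply: definable_sa.
by move=> x; rewrite !sa_set_idfun Epsi.
Qed.

Lemma base_ext_definable (S : rcfType) (h : {rmorphism F -> S}) n (P : set_family n) x :
  definable P -> base_ext h (P F idfun) x <-> P S h x.
Proof.
case=> phi Hphi; rewrite -Hphi -base_extE.
suff -> : P F idfun = sa_set phi by [].
by apply/funext => y; apply/propext; rewrite -Hphi sa_set_idfun.
Qed.

End Definable.

(** * Ultrapowers of a real closed field *)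
Section Ultrapower.
Variables (F : rcfType) (I : Type) (U : set_system I) (UU : UltraFilter U).

Local Instance ultra_filter_proper : ProperFilter U := ultra_proper.

Definition ultra_rel : rel (I -> F) := fun u v => `[< U [set j | u j = v j] >].

Lemma ultra_rel_refl : reflexive ultra_rel.
Proof. by move=> u; apply/asboolP; apply: filterS filterT => j _. Qed.

Lemma ultra_rel_sym : symmetric ultra_rel.
Proof.
by move=> u v; apply/asboolP/asboolP; apply: filterS => j /= ->.
Qed.

Lemma ultra_rel_trans : transitive ultra_rel.
Proof.
move=> v u w /asboolP uv /asboolP vw; apply/asboolP.
by apply: filterS2 uv vw => j /= -> ->.
Qed.

Canonical ultra_equiv :=
  EquivRel ultra_rel ultra_rel_refl ultra_rel_sym ultra_rel_trans.

Definition ultrapower := {eq_quot ultra_equiv}%qT.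
HB.instance Definition _ := Choice.on ultrapower.

Definition uclass (u : I -> F) : ultrapower := (\pi_({eq_quot ultra_equiv}) u)%qT.
Definition urepr (x : ultrapower) : I -> F := repr (x : {eq_quot ultra_equiv}%qT).

Lemma ureprK x : uclass (urepr x) = x. Proof. exact: reprK. Qed.

Lemma uclassP u v : uclass u = uclass v <-> U [set j | u j = v j].
Proof. by split=> [/eqmodP/asboolP //|uv]; apply/eqmodP/asboolP. Qed.

Lemma urepr_class u : U [set j | urepr (uclass u) j = u j].
Proof. by apply/uclassP; rewrite ureprK. Qed.

Definition uadd x y := uclass (fun j => urepr x j + urepr y j).
Definition umul x y := uclass (fun j => urepr x j * urepr y j).
Definition uopp x := uclass (fun j => - urepr x j).
Definition uinv x := uclass (fun j => (urepr x j)^-1).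
Definition uge0 x := `[< U [set j | 0 <= urepr x j] >].

Lemma uaddE u v : uadd (uclass u) (uclass v) = uclass (fun j => u j + v j).
Proof.
by apply/uclassP; apply: filterS2 (urepr_class u) (urepr_class v) => j /= -> ->.
Qed.

Lemma umulE u v : umul (uclass u) (uclass v) = uclass (fun j => u j * v j).
Proof.
by apply/uclassP; apply: filterS2 (urepr_class u) (urepr_class v) => j /= -> ->.
Qed.

Lemma uoppE u : uopp (uclass u) = uclass (fun j => - u j).
Proof. by apply/uclassP; apply: filterS (urepr_class u) => j /= ->. Qed.

Lemma uinvE u : uinv (uclass u) = uclass (fun j => (u j)^-1).
Proof. by apply/uclassP; apply: filterS (urepr_class u) => j /= ->. Qed.

Lemma uge0P u : uge0 (uclass u) <-> U [set j | 0 <= u j].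
Proof.
by split=> [/asboolP|] H; [|apply/asboolP];
  apply: filterS2 (urepr_class u) H => j /= ->.
Qed.

Lemma uaddA : associative uadd.
Proof.
move=> x y z; rewrite -[x]ureprK -[y]ureprK -[z]ureprK !uaddE.
by congr uclass; apply/funext => j; rewrite addrA.
Qed.

Lemma uaddC : commutative uadd.
Proof. by move=> x y; congr uclass; apply/funext => j; rewrite addrC. Qed.

Lemma uadd0 : left_id (uclass (fun=> 0)) uadd.
Proof.
move=> x; rewrite -[x]ureprK uaddE.
by congr uclass; apply/funext => j; rewrite add0r.
Qed.

Lemma uaddN : left_inverse (uclass (fun=> 0)) uopp uadd.
Proof.
move=> x; rewrite -[x]ureprK uoppE uaddE.
by congr uclass; apply/funext => j; rewrite addNr.
Qed.

HB.instance Definition _ := GRing.isZmodule.Build ultrapower uaddA uaddC uadd0 uaddN.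

Lemma umulA : associative umul.
Proof.
move=> x y z; rewrite -[x]ureprK -[y]ureprK -[z]ureprK !umulE.
by congr uclass; apply/funext => j; rewrite mulrA.
Qed.

Lemma umulC : commutative umul.
Proof. by move=> x y; congr uclass; apply/funext => j; rewrite mulrC. Qed.

Lemma umul1 : left_id (uclass (fun=> 1)) umul.
Proof.
move=> x; rewrite -[x]ureprK umulE.
by congr uclass; apply/funext => j; rewrite mul1r.
Qed.

Lemma umulDl : left_distributive umul uadd.
Proof.
move=> x y z; rewrite -[x]ureprK -[y]ureprK -[z]ureprK !(uaddE, umulE).
by congr uclass; apply/funext => j; rewrite mulrDl.
Qed.

Lemma uone_neq0 : uclass (fun=> 1) != uclass (fun=> 0).
Proof.
apply/eqP => /uclassP; rewrite (_ : [set j | _] = set0) => [/filter_not_empty //|].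
by apply/seteqP; split=> // j /= /eqP; rewrite oner_eq0.
Qed.

HB.instance Definition _ :=
  GRing.Zmodule_isComNzRing.Build ultrapower umulA umulC umul1 umulDl uone_neq0.

Lemma uclassD u v : uclass u + uclass v = uclass (fun j => u j + v j).
Proof. exact: uaddE. Qed.

Lemma uclassM u v : uclass u * uclass v = uclass (fun j => u j * v j).
Proof. exact: umulE. Qed.

Lemma uclassN u : - uclass u = uclass (fun j => - u j).
Proof. exact: uoppE. Qed.

Lemma uclass0 : uclass (fun=> 0) = 0. Proof. by []. Qed.
Lemma uclass1 : uclass (fun=> 1) = 1. Proof. by []. Qed.

Lemma umulV (x : ultrapower) : x != 0 -> umul (uinv x) x = 1.
Proof.
rewrite -[x]ureprK; move: (urepr x) => u nz0; rewrite uinvE umulE.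
apply/uclassP; have [u0|] := in_ultra_setVsetC [set j | u j = 0] UU.
  by case/eqP: nz0; apply/uclassP.
by apply: filterS => j /= /eqP nz; rewrite mulVf.
Qed.

Lemma uinv0 : uinv 0 = 0.
Proof. by rewrite -uclass0 uinvE; congr uclass; apply/funext => j; rewrite invr0. Qed.

HB.instance Definition _ := GRing.ComNzRing_isField.Build ultrapower umulV uinv0.

Definition ule x y := uge0 (y - x).
Definition ult x y := (y != x) && ule x y.
Definition unorm x := if uge0 x then x else - x.

Let ule0x x : ule 0 x = uge0 x. Proof. by rewrite /ule subr0. Qed.

Lemma ule0_add x y : ule 0 x -> ule 0 y -> ule 0 (x + y).
Proof.
rewrite !ule0x -[x]ureprK -[y]ureprK => /uge0P x0 /uge0P y0.
rewrite uclassD; apply/uge0P.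
by apply: filterS2 x0 y0 => j /=; apply: addr_ge0.
Qed.

Lemma ule0_mul x y : ule 0 x -> ule 0 y -> ule 0 (x * y).
Proof.
rewrite !ule0x -[x]ureprK -[y]ureprK => /uge0P x0 /uge0P y0.
rewrite uclassM; apply/uge0P.
by apply: filterS2 x0 y0 => j /=; apply: mulr_ge0.
Qed.

Lemma ule0_anti x : ule 0 x -> ule x 0 -> x = 0.
Proof.
rewrite ule0x /ule sub0r -[x]ureprK uclassN => /uge0P x0 /uge0P y0.
apply/uclassP; apply: filterS2 x0 y0 => j /= x0; rewrite oppr_ge0 => x0'.
by apply/eqP; rewrite eq_le x0 x0'.
Qed.

Lemma usub_ge0 x y : ule 0 (y - x) = ule x y. Proof. exact: ule0x. Qed.

Lemma ule0_total x : ule 0 x || ule x 0.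
Proof.
rewrite ule0x /ule sub0r -[x]ureprK uclassN; move: (urepr x) => u.
have [u0|u0] := in_ultra_setVsetC [set j | 0 <= u j] UU.
  by apply/orP; left; apply/uge0P.
apply/orP; right; apply/uge0P; apply: filterS u0 => j /= /negP.
by rewrite -ltNge oppr_ge0 => /ltW.
Qed.

Lemma unormN x : unorm (- x) = unorm x.
Proof.
rewrite /unorm opprK; have := ule0_total x; have := @ule0_anti x.
rewrite ule0x /ule sub0r; case: ifP; case: ifP => // H1 H2 H3 _.
by rewrite H3 // oppr0.
Qed.

Lemma uge0_norm x : ule 0 x -> unorm x = x.
Proof. by rewrite ule0x /unorm => ->. Qed.

Lemma ult_def x y : ult x y = (y != x) && ule x y. Proof. by []. Qed.

HB.instance Definition _ := Num.IntegralDomain_isLeReal.Build ultrapower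
  ule0_add ule0_mul ule0_anti usub_ge0 ule0_total unormN uge0_norm ult_def.

Lemma uclass_ge0 u : 0 <= uclass u <-> U [set j | 0 <= u j].
Proof. by rewrite -uge0P; change (0 <= uclass u) with (ule 0 (uclass u)); rewrite ule0x. Qed.

Lemma uclass_le u v : uclass u <= uclass v <-> U [set j | u j <= v j].
Proof.
rewrite -subr_ge0 uclassN uclassD uclass_ge0.
by split; apply: filterS => j /=; rewrite subr_ge0.
Qed.

Lemma upoly_horner (p : {poly ultrapower}) (u : I -> F) :
  p.[uclass u] = uclass (fun j => (Poly [seq urepr c j | c <- p]).[u j]).
Proof.
rewrite -{1}[p]polyseqK; elim: (polyseq p) => [|c s IHs] /=.
  by rewrite horner0; congr uclass; apply/funext => j; rewrite horner0.
rewrite !cons_poly_def !hornerE IHs -{1}[c]ureprK uclassM uclassD.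
by congr uclass; apply/funext => j; rewrite cons_poly_def !hornerE.
Qed.

(** A polynomial over the ultrapower is a family of polynomials over [F]; a root is
    chosen for each index at which the sign condition holds, which is almost
    every index. *)
Lemma ultrapower_closed : Num.real_closed_axiom ultrapower.
Proof.
move=> p a b; rewrite -[a]ureprK -[b]ureprK; move: (urepr a) (urepr b) => {}a {}b.
rewrite uclass_le !upoly_horner => ab /andP[].
pose q j := Poly [seq urepr c j | c <- p].
rewrite -/q -uclass0 !uclass_le => pa pb.
pose good j := [/\ a j <= b j, (q j).[a j] <= 0 & 0 <= (q j).[b j]].
pose u j := if pselect (good j) is left _ then
  xget 0 [set x | a j <= x <= b j /\ root (q j) x] else 0.
have Ugood : U good by apply: filterS3 ab pa pb => j; split.
have Hu j : good j -> a j <= u j <= b j /\ root (q j) (u j).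
  move=> gj; rewrite /u; case: pselect => // -[ab' qa qb].
  have [|x abx rx] := @poly_ivt _ (q j) (a j) (b j) ab'; first by rewrite qa.
  by case: xgetP => [y -> //|/(_ x)]; case.
exists (uclass u).
  by apply/andP; split; apply/uclass_le;
    apply: filterS Ugood => j /Hu[/andP[]].
apply/eqP; rewrite upoly_horner; apply/uclassP.
by apply: filterS Ugood => j /Hu[_ /eqP].
Qed.

HB.instance Definition _ := Num.RealField_isClosed.Build ultrapower ultrapower_closed.

Definition udiag (c : F) : ultrapower := uclass (fun=> c).

Lemma udiag_is_zmod_morphism : zmod_morphism udiag.
Proof. by move=> x y; rewrite /udiag uclassN uclassD. Qed.

Lemma udiag_is_monoid_morphism : monoid_morphism udiag.
Proof. by split=> // x y; rewrite /udiag uclassM. Qed.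

HB.instance Definition _ :=
  GRing.isZmodMorphism.Build F ultrapower udiag udiag_is_zmod_morphism.
HB.instance Definition _ :=
  GRing.isMonoidMorphism.Build F ultrapower udiag udiag_is_monoid_morphism.

Definition uclass_rV n (u : I -> 'rV[F]_n) : 'rV[ultrapower]_n :=
  \row_k uclass (fun j => u j ord0 k).

Lemma uclass_exp u n : uclass u ^+ n = uclass (fun j => u j ^+ n).
Proof.
elim: n => [|n IHn]; first by rewrite expr0.
by rewrite exprS IHn uclassM; congr uclass; apply/funext => j; rewrite exprS.
Qed.

Lemma uclass_meval n (p : mpoly.mpoly n F) (u : I -> 'rV[F]_n) :
  mpoly.meval (uclass_rV u ord0) (mpoly.map_mpoly udiag p) =
  uclass (fun j => mpoly.meval (u j ord0) p).
Proof.
elim/mpoly.mpolyind: p => [|c m p _ _ IHp].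
  rewrite rmorph0 mpoly.meval0 -uclass0.
  by congr uclass; apply/funext => j; rewrite mpoly.meval0.
rewrite rmorphD /= mpoly.mevalD IHp.
rewrite mpoly.map_mpolyZ mpoly.map_mpolyX mpoly.mevalZ mpoly.mevalX.
have -> : \prod_(k < n) uclass_rV u ord0 k ^+ m k =
    uclass (fun j => \prod_(k < n) u j ord0 k ^+ m k).
  rewrite -big_enum (_ : (fun j => _) =
      fun j => \prod_(k <- enum 'I_n) u j ord0 k ^+ m k); last first.
    by apply/funext => j; rewrite big_enum.
  elim: (enum _) => [|k r IHr].
    by rewrite big_nil -uclass1; congr uclass; apply/funext => j; rewrite big_nil.
  rewrite big_cons /= IHr mxE uclass_exp uclassM.
  by congr uclass; apply/funext => j; rewrite big_cons.
rewrite /= /udiag uclassM uclassD; congr uclass; apply/funext => j.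
by rewrite mpoly.mevalD mpoly.mevalZ mpoly.mevalX.
Qed.

(** The theorem of Los for quantifier-free formulas. *)
Lemma ultrapower_sa_set n (phi : safm F n) (u : I -> 'rV[F]_n) :
  sa_set (sa_map udiag phi) (uclass_rV u) <-> U [set j | sa_set phi (u j)].
Proof.
elim: phi => [p|phi IH|phi IH psi IH'|phi IH psi IH'] /=.
- by rewrite uclass_meval uclass_ge0.
- rewrite /setC /= IH; split=> [nU|Un Up].
    by have [/nU|] := in_ultra_setVsetC [set j | sa_set phi (u j)] UU.
  apply: (@filter_not_empty _ U); apply: filterS2 Un Up => j /=; exact.
- rewrite /setI /= IH IH'; split=> [[H H']|H].
    by apply: filterS2 H H' => j; split.
  by split; apply: filterS H => j [].
- rewrite /setU /= IH IH'; split=> [[]|H].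
  + by apply: filterS => j; left.
  + by apply: filterS => j; right.
  have [|H'] := in_ultra_setVsetC [set j | sa_set phi (u j)] UU; first by left.
  by right; apply: filterS2 H H' => j /= [].
Qed.

End Ultrapower.

(** * Homogenization and positive semidefinite matrices *)
Section Homogenization.
Variables (F : comNzRingType) (n : nat).

Definition homog (a : 'rV[F]_n) : 'rV[F]_n.+1 := row_mx (1 : 'rV_1) a.

Lemma homog0 a : homog a ord0 ord0 = 1.
Proof.
have -> : ord0 = lshift n ord0 :> 'I_(1 + n) by apply: val_inj.
by rewrite (row_mxEl (1 : 'rV_1)) mxE.
Qed.

Lemma homogS a j : homog a ord0 (lift ord0 j) = a ord0 j.
Proof. by rewrite -rshift1 (row_mxEr (1 : 'rV_1)). Qed.

Lemma lin_evalE c (a : 'rV[F]_n) : lin_eval c a = (homog a *m c^T) ord0 ord0.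
Proof.
rewrite mxE big_ord_recl homog0 mul1r mxE /lin_eval; congr (_ + _).
by apply: eq_bigr => j _; rewrite homogS mxE mulrC.
Qed.

End Homogenization.

Lemma tensor_evalE (F S : comNzRingType) (h : {rmorphism F -> S}) n
    (c : 'rV[S]_n.+1) (a : 'rV[S]_n) :
  tensor_eval h c a = \sum_j pure h (homog a ord0 j) (c ord0 j).
Proof.
rewrite big_ord_recl homog0 /tensor_eval; congr (_ + _).
by apply: eq_bigr => j _; rewrite homogS.
Qed.

Section Psd.
Variable F : realDomainType.

Lemma psdmx_gram q d (V : 'M[F]_(q, d)) : psdmx (V^T *m V).
Proof.
split=> [|v]; first by rewrite trmx_mul trmxK.
have -> : v *m (V^T *m V) *m v^T = (v *m V^T) *m (v *m V^T)^T.
  by rewrite trmx_mul trmxK !mulmxA.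
by rewrite mxE sumr_ge0 // => j _; rewrite [X in _ * X]mxE sqr_ge0.
Qed.

Lemma psdmx_congr d r (M : 'M[F]_d) (C : 'M[F]_(d, r)) :
  psdmx M -> psdmx (C^T *m M *m C).
Proof.
case=> symM posM; split=> [|v]; first by rewrite !trmx_mul symM trmxK mulmxA.
by have := posM (v *m C^T); rewrite trmx_mul trmxK !mulmxA.
Qed.

Lemma psdmxD d (M N : 'M[F]_d) : psdmx M -> psdmx N -> psdmx (M + N).
Proof.
case=> sM pM [sN pN]; split=> [|v]; first by rewrite linearD /= sM sN.
by rewrite mulmxDr mulmxDl mxE addr_ge0.
Qed.

Lemma psdmx_block d1 d2 (M : 'M[F]_d1) (N : 'M[F]_d2) :
  psdmx (block_mx M 0 0 N) <-> psdmx M /\ psdmx N.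
Proof.
have E v w : row_mx v w *m block_mx M 0 0 N *m (row_mx v w)^T =
    v *m M *m v^T + w *m N *m w^T :> 'M_1.
  by rewrite mul_row_block !mulmx0 addr0 add0r tr_row_mx mul_row_col.
split=> [[sym pos]|[[sM pM] [sN pN]]].
  move: sym; rewrite tr_block_mx !trmx0 => /eq_block_mx[sM _ _ sN].
  split; split=> // v.
    by have := pos (row_mx v 0); rewrite E trmx0 mulmx0 addr0.
  by have := pos (row_mx 0 v); rewrite E trmx0 mulmx0 add0r.
split=> [|v]; first by rewrite tr_block_mx !trmx0 sM sN.
by rewrite -[v]hsubmxK E mxE addr_ge0.
Qed.

Lemma psdmx_11 (c : F) : psdmx (c%:M : 'M_1) <-> 0 <= c.
Proof.
split=> [[_ /(_ 1)]|c0]; first by rewrite trmx1 mul1mx mulmx1 mxE eqxx mulr1n.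
split=> [|v]; first by rewrite tr_scalar_mx.
rewrite mul_mx_scalar mxE big_ord1 !mxE -mulrA mulr_ge0 //; exact: sqr_ge0.
Qed.

Lemma psdmx0 d : psdmx (0 : 'M[F]_d).
Proof. by split=> [|v]; rewrite ?trmx0 // mulmx0 mul0mx mxE. Qed.

Lemma psdmxZ d (c : F) (M : 'M[F]_d) : 0 <= c -> psdmx M -> psdmx (c *: M).
Proof.
move=> c0 [sM pM]; split=> [|v]; first by rewrite linearZ /= sM.
by rewrite -scalemxAr -scalemxAl mxE mulr_ge0.
Qed.

End Psd.

Lemma block_quad (F : comNzRingType) d (a : 'M[F]_1) (v : 'rV[F]_d) (M : 'M[F]_d) x w :
  row_mx x w *m block_mx a v v^T M *m (row_mx x w)^T =
  x *m a *m x^T + w *m v^T *m x^T + (x *m v *m w^T + w *m M *m w^T) :> 'M_1.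
Proof. by rewrite mul_row_block tr_row_mx mul_row_col !mulmxDl. Qed.

(** Cholesky factorization, keeping track of a right inverse of the factor.  If the
    upper left entry is positive one passes to its Schur complement; if it is zero
    the first row vanishes, since otherwise the quadratic form would take negative
    values. *)
Lemma psdmx_cholesky (F : rcfType) d (M : 'M[F]_d) : psdmx M ->
  exists r (C : 'M[F]_(r, d)) (D : 'M[F]_(d, r)), M = C^T *m C /\ C *m D = 1%:M.
Proof.
elim: d M => [|d IHd] M.
  by exists 0%N, 0, 0; split; apply/matrixP => -[].
rewrite -[M](@submxK _ 1 d 1 d); move: (ulsubmx _) (ursubmx _) (dlsubmx _) (drsubmx _).
move=> a v v' {}M [sym pos].
have [Ea Ev EM] : [/\ a^T = a, v' = v^T & M^T = M].
  by move: sym; rewrite (@tr_block_mx _ 1 d 1 d) => /(@eq_block_mx _ 1 d 1 d)[-> _ -> ->].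
subst v'; clear sym; move: pos.
rewrite {Ea}[a]mx11_scalar; move: (a _ _) => {}a pos.
have quad (x : F) (w : 'rV[F]_d) :
    0 <= x ^+ 2 * a + x * (v *m w^T) ord0 ord0 *+ 2 + (w *m M *m w^T) ord0 ord0.
  have := pos (row_mx x%:M w : 'rV_(1 + d)); rewrite block_quad tr_scalar_mx.
  rewrite !mul_scalar_mx !mul_mx_scalar -!scalemxAl.
  have -> : w *m v^T = v *m w^T.
    by rewrite -[LHS]trmxK [(w *m _)^T]trmx_mul trmxK [v *m w^T]mx11_scalar tr_scalar_mx.
  rewrite !mxE eqxx mulr1n mulrA -expr2; set s := \sum_(_ < _) _.
  by rewrite mulr2n !addrA.
have [a_eq0|a_neq0] := eqVneq a 0.
  have v0 : v = 0.
    apply/matrixP => i j; rewrite [i]ord1 mxE; apply/eqP/negPn/negP => vj.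
    pose w : 'rV[F]_d := delta_mx ord0 j.
    have vE : (v *m w^T) ord0 ord0 = v ord0 j.
      by rewrite trmx_delta -colE mxE.
    (* This abscissa makes the quadratic form equal to -1. *)
    have := quad (- ((w *m M *m w^T) ord0 ord0 + 1) / (v ord0 j *+ 2)) w.
    rewrite a_eq0 mulr0 add0r vE -mulrnAr divfK ?mulrn_eq0 // opprD addrAC addNr add0r.
    by rewrite ler0N1.
  have psdM : psdmx M.
    by split=> // w; have := quad 0 w; rewrite expr0n mul0r mul0r mul0rn !add0r.
  have [r [C [D [MC CD]]]] := IHd _ psdM.
  exists r, (row_mx (0 : 'cV_r) C : 'M_(r, 1 + d)), (col_mx (0 : 'rV_r) D : 'M_(1 + d, r)).
  split; last by rewrite (@mul_row_col _ r 1 d r) mul0mx add0r.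
  rewrite a_eq0 v0 (@tr_row_mx _ r 1 d) (@mul_col_row _ 1 d r 1 d) !trmx0 !mul0mx !mulmx0 -MC.
  by rewrite (_ : 0%:M = 0) //; apply/matrixP => i j; rewrite !mxE mul0rn.
have a_gt0 : 0 < a.
  have := quad 1 0; rewrite expr1n mul1r trmx0 !mulmx0 mxE mulr0 mul0rn !addr0.
  by rewrite le_eqVlt eq_sym (negPf a_neq0).
pose s := Num.sqrt a; have s_neq0 : s != 0 by rewrite sqrtr_eq0 -ltNge.
have ss : s * s = a by rewrite -expr2 sqr_sqrtr // ltW.
have psdM : psdmx (M - a^-1 *: (v^T *m v)).
  split=> [|w]; first by rewrite linearB /= EM linearZ /= trmx_mul trmxK.
  (* This abscissa minimizes the quadratic form for a given w. *)
  have := quad (- (v *m w^T) ord0 ord0 / a) w.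
  have subE (A B : 'M[F]_1) c : (A - c *: B) ord0 ord0 = A ord0 ord0 - c * B ord0 ord0.
    by rewrite !mxE.
  rewrite mulmxBr mulmxBl -scalemxAr -scalemxAl subE.
  have -> : w *m (v^T *m v) *m w^T = (v *m w^T)^T *m (v *m w^T).
    by rewrite trmx_mul trmxK !mulmxA.
  set q := (w *m M *m _) ord0 ord0; rewrite [v *m w^T]mx11_scalar.
  set y := (v *m w^T) ord0 ord0.
  rewrite tr_scalar_mx -scalar_mxM ![(_%:M) _ _]mxE eqxx !mulr1n.
  suff -> : (- y / a) ^+ 2 * a + - y / a * y *+ 2 + q = q - a^-1 * (y * y) by [].
  by field.
have [r [C [D [MC CD]]]] := IHd _ psdM.
exists (1 + r)%N, (block_mx s%:M (s^-1 *: v) 0 C : 'M_(1 + r, 1 + d)).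
exists (block_mx s^-1%:M (- (a^-1 *: (v *m D))) 0 D : 'M_(1 + d, 1 + r)).
split.
  rewrite (@tr_block_mx _ 1 r 1 d) (@mulmx_block _ 1 d 1 r 1 d) trmx0 !mul0mx !mulmx0.
  rewrite !addr0 -MC !tr_scalar_mx -scalar_mxM ss.
  rewrite [(s^-1 *: v)^T]linearZ /= mul_scalar_mx mul_mx_scalar !scalerA divff // !scale1r.
  rewrite -scalemxAl -scalemxAr scalerA -invfM ss [_ + (M - _)]addrC subrK.
  by [].
rewrite (@mulmx_block _ 1 r 1 d 1 r) !mul0mx !mulmx0 !addr0 -scalar_mxM divff //.
rewrite mulmxN mul_scalar_mx scalerA -scalemxAl add0r CD.
have -> : s / a = s^-1 by rewrite -ss invfM mulrA divff // mul1r.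
by rewrite addNr -(@scalar_mx_block _ 1 r).
Qed.

Lemma psdmxP (F : rcfType) d (M : 'M[F]_d) :
  psdmx M <-> exists q (V : 'M[F]_(q, d)), M = V^T *m V.
Proof.
split=> [/psdmx_cholesky[r [C [_ [-> _]]]]|[q [V ->]]]; last exact: psdmx_gram.
by exists r, C.
Qed.

(** * Patterns *)
Lemma mxtrace_mul2 (S : pzSemiRingType) d (A B : 'M[S]_d) :
  \tr (A *m B) = \sum_i \sum_j A i j * B j i.
Proof. by apply: eq_bigr => i _; rewrite mxE. Qed.

(** [pat_lin] is the matrix [L] and [pat_mx] the family of the [M_l]. *)
Record pattern (F : comNzRingType) (n : nat) := Pattern {
  pat_dim : nat;
  pat_size : nat;
  pat_lin : 'M[F]_(pat_dim, n.+1);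
  pat_mx : 'I_pat_dim -> 'M[F]_pat_size;
  pat_sym : forall l, (pat_mx l)^T = pat_mx l }.

Arguments pat_mx [F n] p l.

Section Pattern.
Variables (F : rcfType) (n : nat) (p : pattern F n).
Local Notation m := (pat_dim p).
Local Notation r := (pat_size p).

Definition pencil (S : rcfType) (h : {rmorphism F -> S}) (e : 'rV[S]_m) : 'M[S]_r :=
  \sum_l e ord0 l *: map_mx h (pat_mx p l).

Definition primal : set_family F n := fun S h a =>
  exists e, homog a = e *m map_mx h (pat_lin p) /\ psdmx (pencil h e).

Definition dual : set_family F n.+1 := fun S h f =>
  exists G : 'M[S]_r, psdmx G /\
  forall l, (map_mx h (pat_lin p) *m f^T) l ord0 = \tr (map_mx h (pat_mx p l) *m G).

Lemma definable_psdmx N d (M : forall S : rcfType, {rmorphism F -> S} -> 'rV[S]_N -> 'M[S]_d) :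
  (forall i j, polyfun (fun S h x => M S h x i j)) ->
  definable (fun S h x => psdmx (M S h x)).
Proof.
move=> HM.
have HMl i j : @polyfun F (N + d) (fun S h x => M S h (lsubmx x) i j).
  case: (HM i j) => q Hq.
  have [|q' Hq'] := @polyfun_subst F N (N + d) q (fun S h x => lsubmx x).
    move=> k; apply: polyfun_ext (polyfun_coord F (lshift d k)) => S h x.
    by rewrite mxE.
  by exists q' => S h x; rewrite Hq Hq'.
have Hv j : @polyfun F (N + d) (fun S h x => rsubmx x ord0 j).
  apply: polyfun_ext (polyfun_coord F (rshift N j)) => S h x.
  by rewrite mxE.
have := definable_and
  (definable_all (fun i => definable_all (fun j => definable_eq (HM j i) (HM i j))))
  (definable_forall (definable_ge0 (polyfun_sum (index_enum 'I_d) (fun j =>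
    polyfun_mul (polyfun_sum (index_enum 'I_d) (fun i =>
      polyfun_mul (Hv i) (HMl i j))) (Hv j))))).
apply: definable_ext => S h x; rewrite /psdmx; split=> -[sM pM]; split.
- by apply/matrixP => i j; rewrite mxE.
- move=> v; have := pM v; rewrite row_mxKl row_mxKr mxE.
  by under [X in _ -> is_true (0 <= X)]eq_bigr do rewrite mxE [v^T _ _]mxE.
- by move=> i j; rewrite -{2}sM mxE.
- move=> v; have := pM v; rewrite row_mxKl row_mxKr mxE.
  by under eq_bigr do rewrite mxE [v^T _ _]mxE.
Qed.

Lemma polyfun_homog N (a : forall S : rcfType, {rmorphism F -> S} -> 'rV[S]_N -> 'rV[S]_n) j :
  (forall k, polyfun (fun S h x => a S h x ord0 k)) ->
  polyfun (fun S h x => homog (a S h x) ord0 j).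
Proof.
move=> Ha; case: (unliftP ord0 j) => [k|] ->.
  by apply: polyfun_ext (Ha k) => S h x; rewrite homogS.
by apply: polyfun_ext (polyfun_1 F N) => S h x; rewrite homog0.
Qed.

Lemma definable_primal : definable primal.
Proof.
have He l : @polyfun F (n + m) (fun S h x => rsubmx x ord0 l).
  by apply: polyfun_ext (polyfun_coord F (rshift n l)) => S h x; rewrite mxE.
have Ha j : @polyfun F (n + m) (fun S h x => lsubmx x ord0 j).
  by apply: polyfun_ext (polyfun_coord F (lshift m j)) => S h x; rewrite mxE.
have Hlin j : @polyfun F (n + m) (fun S h x => (rsubmx x *m map_mx h (pat_lin p)) ord0 j).
  apply: polyfun_ext (polyfun_sum (index_enum 'I_m)
    (fun l => polyfun_mul (He l) (polyfun_const _ (pat_lin p l j)))) => S h x.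
  by rewrite mxE; apply: eq_bigr => l _; rewrite [map_mx _ _ _ _]mxE.
have Hpen i j : @polyfun F (n + m) (fun S h x => pencil h (rsubmx x) i j).
  apply: polyfun_ext (polyfun_sum (index_enum 'I_m)
    (fun l => polyfun_mul (He l) (polyfun_const _ (pat_mx p l i j)))) => S h x.
  by rewrite summxE; apply: eq_bigr => l _; rewrite [in RHS]mxE [map_mx _ _ _ _]mxE.
have Heq := definable_all (fun j => definable_eq (polyfun_homog j Ha) (Hlin j)).
apply: definable_ext (definable_exists (definable_and Heq (definable_psdmx Hpen))) => S h a.
split=> -[e [Ee pe]]; exists e; move: Ee pe; rewrite row_mxKl row_mxKr => Ee; split=> //.
  by apply/rowP => j; apply: Ee.
by move=> j; rewrite Ee.
Qed.

Lemma definable_dual : definable dual.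
Proof.
pose N := (n.+1 + r * r)%N.
have HG i j : @polyfun F N (fun S h x => vec_mx (rsubmx x) i j).
  apply: polyfun_ext (polyfun_coord F (rshift n.+1 (mxvec_index i j))) => S h x.
  by rewrite !mxE.
have Hf j : @polyfun F N (fun S h x => lsubmx x ord0 j).
  by apply: polyfun_ext (polyfun_coord F (lshift (r * r) j)) => S h x; rewrite mxE.
have Hlin l : @polyfun F N (fun S h x => (map_mx h (pat_lin p) *m (lsubmx x)^T) l ord0).
  apply: polyfun_ext (polyfun_sum (index_enum 'I_n.+1)
    (fun j => polyfun_mul (polyfun_const _ (pat_lin p l j)) (Hf j))) => S h x.
  by rewrite mxE; apply: eq_bigr => j _; rewrite [map_mx _ _ _ _]mxE [(_^T) _ _]mxE.
have Htr l : @polyfun F N (fun S h x => \tr (map_mx h (pat_mx p l) *m vec_mx (rsubmx x))).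
  apply: polyfun_ext (polyfun_sum (index_enum 'I_r) (fun i =>
    polyfun_sum (index_enum 'I_r) (fun j =>
      polyfun_mul (polyfun_const _ (pat_mx p l i j)) (HG j i)))) => S h x.
  by apply: eq_bigr => i _; rewrite mxE; apply: eq_bigr => j _; rewrite [map_mx _ _ _ _]mxE.
have Heq := definable_all (fun l => definable_eq (Hlin l) (Htr l)).
apply: definable_ext (definable_exists (definable_and (definable_psdmx HG) Heq)) => S h f.
split=> [[G []]|[G [pG EG]]].
  by rewrite row_mxKl row_mxKr => pG EG; exists (vec_mx G).
by exists (mxvec G); rewrite row_mxKl row_mxKr mxvecK.
Qed.

Section Extension.
Variables (S : rcfType) (h : {rmorphism F -> S}).

Lemma mxtrace_pencil (e : 'rV_m) G :
  \tr (pencil h e *m G) = \sum_l e ord0 l * \tr (map_mx h (pat_mx p l) *m G).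
Proof.
rewrite /pencil mulmx_suml linear_sum; apply: eq_bigr => l _.
by rewrite -scalemxAl linearZ.
Qed.

Lemma mxtrace_psd_ge0 d (A B : 'M[S]_d) : psdmx A -> psdmx B -> 0 <= \tr (A *m B).
Proof.
move=> psdA /psdmxP[q [V ->]].
rewrite mulmxA mxtrace_mulC mulmxA sumr_ge0 // => i _.
case: psdA => _ /(_ (row i V)).
congr (0 <= _); rewrite -row_mul [LHS]mxE [RHS]mxE.
apply: eq_bigr => j _.
by rewrite [row _ _ _ _]mxE [(row _ _)^T _ _]mxE [row _ _ _ _]mxE [V^T _ _]mxE.
Qed.

(** The number in the conclusion is the trace of the product of the pencil with the
    dual matrix. *)
Lemma cone_dual_ge0 (e : 'rV[S]_m) f : psdmx (pencil h e) -> dual h f ->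
  0 <= (e *m map_mx h (pat_lin p) *m f^T) ord0 ord0.
Proof.
move=> pe [G [pG EG]]; suff -> : (e *m map_mx h (pat_lin p) *m f^T) ord0 ord0 =
    \tr (pencil h e *m G) by apply: mxtrace_psd_ge0.
rewrite mxtrace_pencil -mulmxA mxE.
by apply: eq_bigr => l _; rewrite EG.
Qed.

Lemma pure_sumr (J : Type) (s : seq J) a (b : J -> S) :
  pure h a (\sum_(j <- s) b j) = \sum_(j <- s) pure h a (b j).
Proof.
have bal := pure_balanced h.
elim: s => [|j s IHs]; last by case: bal => _ Dr _; rewrite !big_cons Dr IHs.
rewrite !big_nil; apply: (@addrI _ (pure h a 0)).
by case: bal => _ <- _; rewrite !addr0.
Qed.

Lemma pure_suml (J : Type) (s : seq J) (a : J -> S) b :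
  pure h (\sum_(j <- s) a j) b = \sum_(j <- s) pure h (a j) b.
Proof.
have bal := pure_balanced h.
elim: s => [|j s IHs]; last by case: bal => Dl _ _; rewrite !big_cons Dl IHs.
by rewrite !big_nil (balanced0l b bal).
Qed.

Lemma pure_scal c a b : pure h (a * h c) b = pure h a (h c * b).
Proof. by rewrite mulrC; case: (pure_balanced h). Qed.

(** With Gram factorizations [U^T U] of the pencil and [V^T V] of the dual matrix,
    the tensor evaluation is the sum over the rows [s] of [U] and [t] of [V] of the
    squares of [sum_i U_si (x) V_ti]. *)
Lemma pattern_tensor_eval a f : primal h a -> dual h f ->
  sum_of_squares (tensor_eval h f a).
Proof.
case=> e [Ea /psdmxP[q [U EU]]] [G [/psdmxP[q' [V ->]] EG]].
exists [seq \sum_i pure h (U s i) (V t i) | s <- enum 'I_q, t <- enum 'I_q'].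
rewrite big_allpairs_dep !big_enum /=.
under eq_bigr do rewrite big_enum /=.
transitivity (\sum_i \sum_k pure h ((U^T *m U) i k) ((V^T *m V) k i)).
  rewrite tensor_evalE -EU.
  transitivity (\sum_l pure h (e ord0 l) ((map_mx h (pat_lin p) *m f^T) l ord0)).
    rewrite Ea; under eq_bigr do rewrite mxE pure_suml.
    rewrite exchange_big; apply: eq_bigr => l _ /=.
    rewrite mxE pure_sumr; apply: eq_bigr => j _.
    by rewrite !mxE pure_scal.
  under [LHS]eq_bigr => l _ do rewrite EG mxtrace_mul2 pure_sumr.
  rewrite exchange_big; apply: eq_bigr => i _ /=.
  under [LHS]eq_bigr => l _ do rewrite pure_sumr.
  rewrite exchange_big; apply: eq_bigr => k _ /=.
  rewrite /pencil summxE pure_suml; apply: eq_bigr => l _.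
  by rewrite !mxE pure_scal.
transitivity (\sum_i \sum_k \sum_s \sum_t
    pure h (U s i) (V t i) * pure h (U s k) (V t k)).
  apply: eq_bigr => i _; apply: eq_bigr => k _.
  rewrite mxE pure_suml; apply: eq_bigr => s _.
  rewrite [in X in pure h _ X]mxE pure_sumr; apply: eq_bigr => t _.
  by rewrite pureM !mxE [V t k * _]mulrC.
under [LHS]eq_bigr do rewrite exchange_big /=.
rewrite exchange_big; apply: eq_big => //= s _.
under [LHS]eq_bigr do rewrite exchange_big /=.
rewrite exchange_big; apply: eq_big => //= t _.
rewrite expr2 mulr_suml; apply: eq_bigr => i _.
by rewrite mulr_sumr.
Qed.

End Extension.
End Pattern.

(** * From a sum of squares to a pattern *)
Section TensorRelations.
Variables (F S : rcfType) (h : {rmorphism F -> S}).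

(** A derivation of the congruence involves finitely many left factors; it is
    respected by any functional that is linear on a subspace containing them.
    This avoids extending functionals to the whole of [S]. *)
Lemma tensor_cong_functional t t' : tensor_cong h t t' ->
  exists V : seq S, forall (P : S -> Prop) (phi : S -> F),
    (forall x y, P x -> P y -> phi (x + y) = phi x + phi y) ->
    (forall c x, P x -> phi (h c * x) = c * phi x) ->
    (forall x, x \in V -> P x) ->
    \sum_(x <- t) h (phi x.1) * x.2 = \sum_(x <- t') h (phi x.1) * x.2.
Proof.
elim=> {t t'} [t|t t' _ [V E]|t u v _ [V E] _ [V' E']|t t' u u' _ [V E] _ [V' E']
  |t u|b|a a' b|a b b'|r a b].
- by exists [::].
- by exists V => P phi Dphi Zphi HV; rewrite (E P phi).
- exists (V ++ V') => P phi Dphi Zphi HV.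
  by rewrite (E P phi) ?(E' P phi) // => x xV; apply: HV; rewrite mem_cat xV ?orbT.
- exists (V ++ V') => P phi Dphi Zphi HV; rewrite !big_cat /=.
  by rewrite (E P phi) ?(E' P phi) // => x xV; apply: HV; rewrite mem_cat xV ?orbT.
- by exists [::] => P phi *; rewrite !big_cat /= addrC.
- exists [:: 0] => P phi Dphi Zphi HV; rewrite big_seq1 big_nil /=.
  have P0 : P 0 by apply: HV; rewrite inE.
  by have := Zphi 0 0 P0; rewrite mulr0 mul0r => ->; rewrite rmorph0 mul0r.
- exists [:: a; a'] => P phi Dphi Zphi HV; rewrite !big_cons !big_nil /=.
  by rewrite !addr0 Dphi ?rmorphD ?mulrDl //; apply: HV; rewrite !inE eqxx ?orbT.
- by exists [::] => P phi Dphi Zphi HV; rewrite !big_cons !big_nil /= !addr0 mulrDr.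
- exists [:: a] => P phi Dphi Zphi HV; rewrite !big_seq1 /=.
  rewrite Zphi; last by apply: HV; rewrite inE.
  by rewrite rmorphM mulrCA mulrA.
Qed.

Definition comb m (e : 'rV[S]_m) (c : 'rV[F]_m) : S := \sum_l e ord0 l * h (c ord0 l).

Lemma combD m (e : 'rV[S]_m) c d : comb e (c + d) = comb e c + comb e d.
Proof.
by rewrite -big_split; apply: eq_bigr => l _; rewrite mxE rmorphD mulrDr.
Qed.

Lemma combZ m (e : 'rV[S]_m) x c : comb e (x *: c) = h x * comb e c.
Proof.
by rewrite mulr_sumr; apply: eq_bigr => l _; rewrite mxE rmorphM mulrCA.
Qed.

Lemma finite_basis (V : seq S) : exists m (e : 'rV[S]_m),
  (forall c, comb e c = 0 -> c = 0) /\ forall x, x \in V -> exists c, x = comb e c.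
Proof.
elim: V => [|x V [m [e [free gen]]]].
  by exists 0%N, 0; split=> // c _; apply/rowP => -[].
have [[c xE]|nx] := pselect (exists c, x = comb e c).
  exists m, e; split=> // y; rewrite inE => /predU1P[->|/gen //].
  by exists c.
have E (c : 'rV[F]_(m + 1)) : comb (row_mx e x%:M) c =
    comb e (lsubmx c) + x * h (rsubmx c ord0 ord0).
  rewrite /comb big_split_ord big_ord1 /= row_mxEr !mxE eqxx mulr1n; congr (_ + _).
  by apply: eq_bigr => l _; rewrite row_mxEl mxE.
exists (m + 1)%N, (row_mx e x%:M); split=> [c|y].
  rewrite E => c0; have d0 : rsubmx c ord0 ord0 = 0.
    apply: contra_notP nx => /eqP; set d := rsubmx c _ _ => d_neq0.
    exists (- d^-1 *: lsubmx c); rewrite combZ.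
    move/eqP: c0; rewrite addr_eq0 => /eqP ->.
    by rewrite rmorphN mulrNN mulrC -mulrA -rmorphM divff // rmorph1 mulr1.
  move: c0; rewrite d0 rmorph0 mulr0 addr0 => /free l0.
  rewrite -[c]hsubmxK l0; apply/rowP => j; rewrite mxE.
  case: splitP => k _; first by rewrite !mxE.
  by rewrite [k]ord1 d0 mxE.
rewrite inE => /predU1P[->|/gen[c ->]].
  exists (row_mx 0 1%:M); rewrite E row_mxKl row_mxKr [(1%:M : 'M_1) _ _]mxE eqxx rmorph1 mulr1.
  by rewrite /comb big1 ?add0r // => l _; rewrite mxE rmorph0 mulr0.
by exists (row_mx c 0); rewrite E row_mxKl row_mxKr [(0 : 'M_1) _ _]mxE rmorph0 mulr0 addr0.
Qed.

(** Left factors are written in a basis, and the coordinate functionals are applied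
    to both sides. *)
Lemma tensor_coordinates t t' : tclass h t = tclass h t' ->
  exists m (e : 'rV[S]_m) (coord : S -> 'rV[F]_m),
    (forall x, x \in t ++ t' -> x.1 = comb e (coord x.1)) /\
    forall l, \sum_(x <- t) h (coord x.1 ord0 l) * x.2 =
              \sum_(x <- t') h (coord x.1 ord0 l) * x.2.
Proof.
move/tclassP/tensor_cong_functional => [V HV].
have [m [e [free gen]]] := finite_basis (V ++ map fst (t ++ t')).
pose coord x := xget 0 [set c | x = comb e c].
have coordE x : (exists c, x = comb e c) -> x = comb e (coord x).
  by case=> c xc; rewrite /coord; case: xgetP => [y _ //|/(_ c)].
have coordK c : coord (comb e c) = c.
  apply/eqP; rewrite -subr_eq0; apply/eqP; apply: free.
  rewrite combD -scaleN1r combZ rmorphN1 mulN1r -coordE ?subrr //.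
  by exists c.
exists m, e, coord; split=> [x xt|l].
  by apply/coordE/gen; rewrite mem_cat map_f ?orbT.
apply: (HV (fun x => exists c, x = comb e c) (fun x => coord x ord0 l)).
- by move=> _ _ [c ->] [d ->]; rewrite -combD !coordK mxE.
- by move=> c _ [d ->]; rewrite -combZ !coordK mxE.
- by move=> x xV; apply: gen; rewrite mem_cat xV.
Qed.

Lemma tclass_sum t : tclass h t = \sum_(x <- t) pure h x.1 x.2.
Proof.
elim: t => [|[a b] t IHt]; first by rewrite big_nil.
by rewrite big_cons -IHt -[(a, b) :: t]cat1s -tclassD.
Qed.

(** A square [(sum_i v_i (x) w_i)^2] is the tensor [sum_ik v_i v_k (x) w_i w_k], whose
    right factors form a matrix of rank one; sums of squares are combined in block
    diagonal form. *)
Lemma sum_of_squares_gram x : sum_of_squares x ->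
  exists r (u : 'rV[S]_r) (G : 'M[S]_r), psdmx G /\
    x = \sum_i \sum_k pure h (u ord0 i * u ord0 k) (G i k).
Proof.
case=> s ->; elim: s => [|y s [r [u [G [pG EG]]]]].
  exists 0%N, 0, 0; split; last by rewrite big_nil big_ord0.
  exact: psdmx0.
pose t := trepr y; pose d := size t.
pose v : 'rV[S]_d := \row_i (nth (0, 0) t i).1.
pose w : 'rV[S]_d := \row_i (nth (0, 0) t i).2.
have Ey : y = \sum_i pure h (v ord0 i) (w ord0 i).
  rewrite -[y]treprK tclass_sum (big_nth (0, 0)) big_mkord.
  by apply: eq_bigr => i _; rewrite !mxE.
exists (r + d)%N, (row_mx u v), (block_mx G 0 0 (w^T *m w)); split.
  by apply/psdmx_block; split=> //; apply: psdmx_gram.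
have pure0 a : pure h a 0 = 0.
  by have := @pure_sumr F S h nat [::] a (fun=> 0); rewrite !big_nil.
rewrite big_cons EG addrC big_split_ord /=; congr (_ + _).
  apply: eq_bigr => i _; rewrite big_split_ord /= [X in _ = _ + X]big1 ?addr0.
    by apply: eq_bigr => k _; rewrite !row_mxEl block_mxEul.
  by move=> k _; rewrite block_mxEur [in X in pure h _ X]mxE pure0.
rewrite Ey expr2 mulr_suml; apply: eq_bigr => i _.
rewrite mulr_sumr big_split_ord /= [X in _ = X + _]big1 ?add0r.
  apply: eq_bigr => k _.
  by rewrite !row_mxEr block_mxEdr pureM [(w^T *m w) _ _]mxE big_ord1 [w^T _ _]mxE.
by move=> k _; rewrite block_mxEdl [in X in pure h _ X]mxE pure0.
Qed.

(** The coordinates of the left factors [1], [a_j] and [u_i u_k] in a basis over [F]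
    are the parameters of the pattern.  The Gram matrix [u^T u] witnesses the primal
    part and [G] the dual part. *)
Lemma sum_of_squares_pattern n (a : 'rV[S]_n) f :
  sum_of_squares (tensor_eval h f a) ->
  exists p : pattern F n, primal p h a /\ dual p h f.
Proof.
move/sum_of_squares_gram => [r [u [G [pG EG]]]].
pose t := [seq (homog a ord0 j, f ord0 j) | j <- enum 'I_n.+1].
pose t' := [seq (u ord0 i * u ord0 k, G i k) | i <- enum 'I_r, k <- enum 'I_r].
have Et (V : zmodType) (B : S -> S -> V) :
    \sum_(x <- t) B x.1 x.2 = \sum_j B (homog a ord0 j) (f ord0 j).
  by rewrite big_map big_enum.
have Et' (V : zmodType) (B : S -> S -> V) :
    \sum_(x <- t') B x.1 x.2 = \sum_i \sum_k B (u ord0 i * u ord0 k) (G i k).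
  rewrite big_allpairs_dep big_enum; apply: eq_bigr => i _ /=.
  by rewrite big_enum.
have [|m [e [coord [coordE Ecoord]]]] := @tensor_coordinates t t'.
  by rewrite !tclass_sum Et Et' -tensor_evalE EG.
pose M (l : 'I_m) : 'M[F]_r := \matrix_(i, k) coord (u ord0 i * u ord0 k) ord0 l.
have symM l : (M l)^T = M l.
  by apply/matrixP => i k; rewrite !mxE mulrC.
pose p := Pattern (\matrix_(l, j) coord (homog a ord0 j) ord0 l) symM.
exists p; split.
  exists e; split.
    apply/rowP => j; transitivity (comb e (coord (homog a ord0 j))).
      apply: (coordE (homog a ord0 j, f ord0 j)).
      by rewrite mem_cat map_f // mem_enum.
    by rewrite [RHS]mxE; apply: eq_bigr => l _; rewrite !mxE.
  suff -> : @pencil F n p S h e = u^T *m u by apply: psdmx_gram.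
  apply/matrixP => i k; rewrite summxE mxE big_ord1 [u^T _ _]mxE.
  transitivity (comb e (coord (u ord0 i * u ord0 k))).
    by apply: eq_bigr => l _; rewrite !mxE.
  apply/esym/(coordE (u ord0 i * u ord0 k, G i k)).
  rewrite mem_cat orbC; apply/orP; left.
  by apply/allpairsP; exists (i, k); rewrite !mem_enum.
exists G; split=> // l /=; have := Ecoord l.
rewrite (Et _ (fun x y => h (coord x ord0 l) * y)).
rewrite (Et' _ (fun x y => h (coord x ord0 l) * y)).
rewrite mxE mxtrace_mul2 => E; transitivity (\sum_j h (coord (homog a ord0 j) ord0 l) * f ord0 j).
  by apply: eq_bigr => j _; rewrite !mxE.
rewrite E; apply: eq_bigr => i _; apply: eq_bigr => k _.
case: pG => sG _.
by rewrite !mxE -{1}sG mxE.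
Qed.

End TensorRelations.

(** * Positive extension and conic duality *)
Section Riesz.
Variables (R : realType) (N : nat) (P : set 'rV[R]_N).
Hypothesis PD : forall x y, P x -> P y -> P (x + y).
Hypothesis PZ : forall c x, 0 <= c -> P x -> P (c *: x).

Definition positive_on m (Y : 'M[R]_(m, N)) (g : 'cV[R]_m) :=
  forall y : 'rV_m, P (y *m Y) -> 0 <= (y *m g) ord0 ord0.

(** The value [c] at the new vector [x] must satisfy [- g y <= c] whenever
    [y Y + x] is in the cone and [c <= g y'] whenever [y' Y - x] is.  These bounds are
    consistent because adding the two memberships eliminates [x]. *)
Lemma riesz_step m (Y : 'M[R]_(m, N)) (g : 'cV[R]_m) (x : 'rV[R]_N) :
  (forall x', exists y : 'rV_m, P (y *m Y + x')) -> positive_on Y g ->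
  exists c : R, forall (y : 'rV_m) t, P (y *m Y + t *: x) ->
    0 <= (y *m g) ord0 ord0 + t * c.
Proof.
move=> cofinal pos; pose A := [set s | exists2 y, P (y *m Y + x) & s = - (y *m g) ord0 ord0].
have ubA (y' : 'rV_m) : P (y' *m Y - x) -> ubound A ((y' *m g) ord0 ord0).
  move=> Py' s [y Py ->]; rewrite -subr_ge0 opprK.
  have -> : (y' *m g) ord0 ord0 + (y *m g) ord0 ord0 = ((y' + y) *m g) ord0 ord0.
    by rewrite mulmxDl [RHS]mxE.
  apply: pos; rewrite mulmxDl.
  by have := PD Py' Py; rewrite addrACA addNr addr0.
have supA : has_sup A.
  split; first by have [y Py] := cofinal x; exists (- (y *m g) ord0 ord0), y.
  by have [y Py] := cofinal (- x); exists ((y *m g) ord0 ord0); apply: ubA.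
have scale (c : R) (y : 'rV_m) t : 0 <= c -> P (y *m Y + t *: x) ->
    P ((c *: y) *m Y + (c * t) *: x).
  by move=> c0 /(PZ c0); rewrite scalerDr scalemxAl scalerA.
have gZ (c : R) (y : 'rV_m) : ((c *: y) *m g) ord0 ord0 = c * (y *m g) ord0 ord0.
  by rewrite -scalemxAl mxE.
exists (sup A) => y t Pyt; have [t0|t0|t0] := ltgtP t 0.
- have nt0 : 0 < - t by rewrite oppr_gt0.
  have := scale (- t)^-1 y t; rewrite invr_ge0 ltW // => /(_ isT Pyt).
  rewrite invrN mulNr mulVf ?lt_eqF // scaleN1r => /ubA ub.
  have : sup A <= ((- t^-1 *: y) *m g) ord0 ord0 by apply: ge_sup; case: supA.
  rewrite gZ -(ler_pM2l nt0) [X in _ <= X]mulrA mulrNN divff ?lt_eqF // mul1r mulNr.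
  by rewrite -subr_ge0 opprK.
- have := scale t^-1 y t; rewrite invr_ge0 ltW // => /(_ isT Pyt).
  rewrite mulVf ?gt_eqF // scale1r => Py.
  have : - ((t^-1 *: y) *m g) ord0 ord0 <= sup A.
    by apply: ub_le_sup; [case: supA | exists (t^-1 *: y)].
  rewrite gZ -(ler_pM2l t0) mulrN mulrA divff ?gt_eqF // mul1r.
  by rewrite -subr_ge0 opprK addrC.
- by move: Pyt; rewrite t0 scale0r mul0r !addr0 => /pos.
Qed.

(** The extension theorem of M. Riesz, obtained by adjoining the vectors of the
    standard basis one at a time. *)
Lemma riesz_extension m (Y : 'M[R]_(m, N)) (g : 'cV[R]_m) :
  (forall x, exists y : 'rV_m, P (y *m Y + x)) -> positive_on Y g ->
  exists c : 'cV[R]_N, (forall x, P x -> 0 <= (x *m c) ord0 ord0) /\ g = Y *m c.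
Proof.
move=> cofinal pos.
have P0 : P 0.
  by have [y Py] := cofinal 0; have := PZ (lexx 0) Py; rewrite scale0r.
suff [c Hc] : exists c : 'cV[R]_N, forall (y : 'rV_m) (t : 'rV_N),
    P (y *m Y + t *m 1%:M) -> 0 <= (y *m g) ord0 ord0 + (t *m c) ord0 ord0.
  exists c; split=> [x Px|].
    by have := Hc 0 x; rewrite mulmx1 !mul0mx mxE !add0r; apply.
  have ge (y : 'rV_m) : 0 <= (y *m (g - Y *m c)) ord0 ord0.
    have := Hc y (- (y *m Y)); rewrite mulmx1 subrr => /(_ P0).
    by rewrite mulmxBr mulmxA mulNmx [in X in _ -> X]mxE.
  apply/colP => l; have := ge (delta_mx ord0 l); have := ge (- delta_mx ord0 l).
  rewrite mulNmx -rowE !mxE oppr_ge0 => le0 ge0.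
  by apply/eqP; rewrite -subr_eq0 eq_le le0 ge0.
suff H k (X : 'M[R]_(k, N)) : exists c : 'cV[R]_k, forall (y : 'rV_m) (t : 'rV_k),
    P (y *m Y + t *m X) -> 0 <= (y *m g) ord0 ord0 + (t *m c) ord0 ord0.
  exact: H.
elim: k X => [|k IHk] X.
  exists 0 => y t; rewrite [t]thinmx0 mul0mx addr0 => /pos.
  by rewrite mul0mx [(0 : 'M_1) _ _]mxE addr0.
rewrite -[X](@vsubmxK _ 1 k); move: (usubmx _) (dsubmx _) => x {}X.
have [c Hc] := IHk X.
have [||c0 Hc0] := @riesz_step (m + k) (col_mx Y X) (col_mx g c) x.
- move=> x'; have [y Py] := cofinal x'; exists (row_mx y 0).
  by rewrite mul_row_col mul0mx addr0.
- move=> y; rewrite -[y]hsubmxK !mul_row_col => /Hc; by rewrite [in X in _ -> X]mxE.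
exists (col_mx c0%:M c : 'cV_(1 + k)) => y t.
rewrite -[t](@hsubmxK _ 1 1 k); move: (lsubmx _) (rsubmx _) => t0 {}t.
rewrite !(@mul_row_col _ 1 1 k) [t0]mx11_scalar; move: (t0 _ _) => {}t0.
rewrite mul_scalar_mx [t0 *: x + _]addrC addrA -(mul_row_col y t) => /Hc0.
rewrite mul_row_col -scalar_mxM.
have addE (A B : 'M[R]_1) : (A + B) ord0 ord0 = A ord0 ord0 + B ord0 ord0 by rewrite mxE.
by rewrite !addE [(t0 * c0)%:M _ _]mxE eqxx mulr1n -addrA [t0 * c0 + _]addrC.
Qed.

End Riesz.

Lemma mxtrace_mxvec (F : comNzRingType) d (A B : 'M[F]_d) :
  (mxvec A *m (mxvec B)^T) ord0 ord0 = \tr (A *m B^T).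
Proof.
rewrite mxE (reindex _ (curry_mxvec_bij _ _)) /= mxtrace_mul2 pair_bigA.
by apply: eq_bigr => -[i j] _ /=; rewrite [(mxvec B)^T _ _]mxE !mxvecE [B^T _ _]mxE.
Qed.

Definition lincomb (F : nzRingType) m d (XX : 'I_m -> 'M[F]_d) (z : 'rV[F]_m) : 'M[F]_d :=
  \sum_l z ord0 l *: XX l.

Section Lincomb.
Variables (F : comNzRingType) (m d : nat) (XX : 'I_m -> 'M[F]_d).

Lemma lincombD z w : lincomb XX (z + w) = lincomb XX z + lincomb XX w.
Proof. by rewrite -big_split; apply: eq_bigr => l _; rewrite mxE scalerDl. Qed.

Lemma lincombZ c z : lincomb XX (c *: z) = c *: lincomb XX z.
Proof. by rewrite scaler_sumr; apply: eq_bigr => l _; rewrite mxE scalerA. Qed.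

Lemma lincomb0 : lincomb XX 0 = 0.
Proof. by apply: big1 => l _; rewrite mxE scale0r. Qed.

Lemma lincomb_tr z : (forall l, (XX l)^T = XX l) -> (lincomb XX z)^T = lincomb XX z.
Proof.
by move=> sX; rewrite raddf_sum; apply: eq_bigr => l _; rewrite /= linearZ /= sX.
Qed.

Lemma lincomb_mul k (w : 'rV_k) (G : 'M[F]_(k, m)) :
  lincomb XX (w *m G) = lincomb (fun l => lincomb XX (row l G)) w.
Proof.
rewrite mulmx_sum_row [RHS]/lincomb.
elim: (index_enum _) => [|l s IHs]; first by rewrite !big_nil lincomb0.
by rewrite !big_cons lincombD lincombZ IHs.
Qed.

Lemma lincomb_congr r (C : 'M[F]_(d, r)) z :
  C^T *m lincomb XX z *m C = lincomb (fun l => C^T *m XX l *m C) z.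
Proof.
rewrite mulmx_sumr mulmx_suml; apply: eq_bigr => l _.
by rewrite -scalemxAr -scalemxAl.
Qed.

End Lincomb.

Section Duality.
Variable R : realType.

(** The identity is an order unit. *)
Lemma quad_ge (d : nat) (M : 'M[R]_d) : exists c, forall v : 'rV_d,
  0 <= (v *m (c *: 1%:M + M) *m v^T) ord0 ord0.
Proof.
exists (\sum_i \sum_j `|M i j|) => v.
have E : (v *m M *m v^T) ord0 ord0 = \sum_i \sum_j M i j * (v ord0 i * v ord0 j).
  rewrite mxE; under eq_bigr do rewrite mxE mulr_suml.
  rewrite exchange_big; apply: eq_bigr => i _; apply: eq_bigr => j _.
  by rewrite [v^T _ _]mxE mulrAC mulrC.
rewrite mulmxDr mulmxDl -scalemxAr -scalemxAl mulmx1 mxE E [X in X + _]mxE.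
set q := (v *m v^T) ord0 ord0.
have qE : q = \sum_i v ord0 i ^+ 2 by rewrite /q mxE; apply: eq_bigr => i _; rewrite mxE.
have q_ge i : v ord0 i ^+ 2 <= q.
  by rewrite qE (bigD1 i) //= lerDl sumr_ge0 // => j _; rewrite sqr_ge0.
rewrite mulr_suml -big_split /= sumr_ge0 // => i _.
rewrite mulr_suml -big_split /= sumr_ge0 // => j _.
have := q_ge i; have := q_ge j; move: q {E qE q_ge} (v ord0 i) (v ord0 j) => q x y Hy Hx.
have xy : `|x * y| <= q.
  by rewrite ler_norml; apply/andP; split; nra.
have : `|M i j * (x * y)| <= `|M i j| * q.
  by rewrite normrM ler_wpM2l.
by rewrite ler_norml => /andP[H _]; rewrite -lerBlDl sub0r.
Qed.

(** Conic duality under a Slater condition, normalized so that the identity belongs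
    to the pencil.  The extension theorem is applied in the space of all matrices,
    to the cone of those whose quadratic form is nonnegative: it contains the skew
    matrices and their opposites, so the matrix [G] representing the extended
    functional is symmetric. *)
Lemma psd_duality m d (XX : 'I_m -> 'M[R]_d) (g : 'cV[R]_m) y0 :
  (forall l, (XX l)^T = XX l) -> lincomb XX y0 = 1%:M ->
  (forall y, psdmx (lincomb XX y) -> 0 <= (y *m g) ord0 ord0) ->
  exists G : 'M[R]_d, psdmx G /\ forall l, g l ord0 = \tr (XX l *m G).
Proof.
move=> symX X0 pos.
pose P : set 'rV[R]_(d * d) := [set x | forall v : 'rV_d, 0 <= (v *m vec_mx x *m v^T) ord0 ord0].
pose Y : 'M[R]_(m, d * d) := \matrix_l mxvec (XX l).
have YE (y : 'rV_m) : vec_mx (y *m Y) = lincomb XX y.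
  rewrite mulmx_sum_row linear_sum; apply: eq_bigr => l _.
  by rewrite linearZ /= rowK mxvecK.
have [||||c [cP gE]] := @riesz_extension R (d * d) P _ _ m Y g.
- by move=> x y Px Py v; rewrite linearD /= mulmxDr mulmxDl mxE addr_ge0.
- by move=> a x a0 Px v; rewrite linearZ /= -scalemxAr -scalemxAl mxE mulr_ge0.
- move=> x; have [a Ha] := quad_ge (vec_mx x); exists (a *: y0) => v.
  by rewrite linearD /= YE lincombZ X0.
- by move=> y Py; apply: pos; split=> [|v]; [exact: lincomb_tr | rewrite -YE].
have cE (A : 'M[R]_d) : (mxvec A *m c) ord0 ord0 = \tr (A *m (vec_mx c^T)^T).
  by rewrite -mxtrace_mxvec vec_mxK trmxK.
pose G := (vec_mx c^T)^T.
have quadG (v : 'rV[R]_d) : (v *m G *m v^T) ord0 ord0 = (mxvec (v^T *m v) *m c) ord0 ord0.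
  by rewrite cE -/G -[v^T *m v *m G]mulmxA mxtrace_mulC /mxtrace big_ord1.
exists G; split=> [|l]; last by rewrite -cE gE mxE [in RHS]mxE; apply: eq_bigr => j _; rewrite mxE.
split=> [|v]; last first.
  rewrite quadG; apply: cP => w; rewrite mxvecK.
  have -> : w *m (v^T *m v) *m w^T = (w *m v^T) *m (w *m v^T)^T.
    by rewrite trmx_mul trmxK !mulmxA.
  by rewrite mxE big_ord1 [X in _ * X]mxE -expr2 sqr_ge0.
have skew (A : 'M[R]_d) : A^T = - A -> \tr (A *m G) = 0.
  move=> sA; have skewP (B : 'M[R]_d) : B^T = - B -> P (mxvec B).
    move=> sB v; rewrite mxvecK.
    have : (v *m B *m v^T)^T = - (v *m B *m v^T).
      by rewrite !trmx_mul trmxK sB mulNmx mulmxN mulmxA.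
    move/matrixP/(_ ord0 ord0); rewrite [LHS]mxE [RHS]mxE => /eqP.
    by rewrite -addr_eq0 -mulr2n mulrn_eq0 => /eqP ->.
  apply/eqP; rewrite eq_le -oppr_ge0 -linearN /= -mulNmx -!cE !cP //; apply: skewP => //.
  by rewrite linearN /= sA.
apply/matrixP => i j; rewrite mxE.
have := skew (delta_mx i j - delta_mx j i).
rewrite linearB /= !trmx_delta opprB => /(_ erefl).
rewrite mulmxBl linearB /= => /eqP; rewrite subr_eq0 => /eqP.
have trE k l : \tr (delta_mx k l *m G) = G l k.
  rewrite mxtrace_mul2 (bigD1 k) //= [X in _ + X]big1 ?addr0; last first.
    by move=> k' kk'; rewrite big1 // => l' _; rewrite mxE (negPf kk') mul0r.
  rewrite (bigD1 l) //= big1 ?addr0 ?mxE ?eqxx ?mul1r // => l' ll'.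
  by rewrite mxE (negPf ll') andbF mul0r.
by rewrite !trE.
Qed.

End Duality.

(** * A single pattern for a spectrahedral shadow *)
Section FacialReduction.
Variable F : rcfType.

Lemma row_norm_eq0 d (w : 'rV[F]_d) : (w *m w^T) ord0 ord0 = 0 -> w = 0.
Proof.
rewrite mxE => /eqP; rewrite psumr_eq0 => [/allP w0|j _]; last first.
  by rewrite [w^T _ _]mxE -expr2 sqr_ge0.
apply/rowP => j; have := w0 j (mem_index_enum _).
by rewrite [w^T _ _]mxE -expr2 sqrf_eq0 mxE => /eqP.
Qed.

Lemma psdmx_isotropic d (M : 'M[F]_d) (v : 'rV[F]_d) :
  psdmx M -> (v *m M *m v^T) ord0 ord0 = 0 -> v *m M = 0.
Proof.
move=> /psdmxP[q [V ->]] H; rewrite mulmxA.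
suff -> : v *m V^T = 0 by rewrite mul0mx.
by apply: row_norm_eq0; rewrite -H trmx_mul trmxK !mulmxA.
Qed.

Lemma psdmx_kerD d (M N : 'M[F]_d) k (E : 'M[F]_(k, d)) :
  psdmx M -> psdmx N -> E *m (M + N) = 0 -> E *m M = 0 /\ E *m N = 0.
Proof.
move=> pM pN E0.
suff H i : row i E *m M = 0 /\ row i E *m N = 0.
  by split; apply/row_matrixP => i; rewrite row_mul row0; case: (H i).
have : row i E *m (M + N) = 0 by rewrite -row_mul E0 row0.
move: (row i E) => v v0.
have : (v *m M *m v^T) ord0 ord0 + (v *m N *m v^T) ord0 ord0 = 0.
  have := congr1 (fun w => (w *m v^T) ord0 ord0) v0.
  by rewrite mulmxDr mulmxDl mul0mx [LHS]mxE [RHS]mxE.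
move/eqP; rewrite paddr_eq0; [|exact: pM.2|exact: pN.2].
by case/andP=> /eqP Mv /eqP Nv; split; apply: psdmx_isotropic.
Qed.

(** Since the rank of [X0] is maximal, the kernel of [X0] is contained in that of
    [X0 + X], hence in that of [X]; thus [X] is a congruence transform by the
    Cholesky factor [C] of [X0]. *)
Lemma psdmx_max_rank d (X0 X : 'M[F]_d) r (C : 'M[F]_(r, d)) (D : 'M[F]_(d, r)) :
  psdmx X0 -> psdmx X -> (\rank (X0 + X)%R <= \rank X0)%N ->
  X0 = C^T *m C -> C *m D = 1%:M -> X = C^T *m (D^T *m X *m D) *m C.
Proof.
move=> pX0 pX rk X0E CD; pose E := 1%:M - C^T *m D^T.
have EX0 : E *m X0 = 0.
  rewrite mulmxBl mul1mx X0E mulmxA -(mulmxA C^T) -trmx_mul CD trmx1 mulmx1.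
  exact: subrr.
have kerX0 : (kermx X0 <= kermx (X0 + X))%MS.
  have sub : (kermx (X0 + X) <= kermx X0)%MS.
    by apply/sub_kermxP; case: (psdmx_kerD pX0 pX (mulmx_ker _)).
  by rewrite -(mxrank_leqif_sup sub) eqn_leq (mxrankS sub) /= !mxrank_ker leq_sub2l.
have EX : E *m X = 0.
  have /sub_kermxP : (E <= kermx (X0 + X))%MS.
    by apply: submx_trans kerX0; apply/sub_kermxP.
  by case/(psdmx_kerD pX0 pX).
have XE : X = C^T *m D^T *m X.
  by apply/eqP; rewrite -subr_eq0 -{1}[X]mul1mx -mulmxBl EX.
have XE' : X = X *m D *m C.
  by have := congr1 trmx XE; rewrite !trmx_mul !trmxK pX.1 mulmxA.
by rewrite !mulmxA -XE.
Qed.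

End FacialReduction.

Section ShadowPattern.
Variable R : realType.

Lemma max_rank_psd s d (XX : 'I_s -> 'M[R]_d) :
  exists z0, psdmx (lincomb XX z0) /\ forall z, psdmx (lincomb XX z) ->
    (\rank (lincomb XX z) <= \rank (lincomb XX z0))%N.
Proof.
pose P k := `[< exists2 z, psdmx (lincomb XX z) & \rank (lincomb XX z) = k >].
have exP : exists k, P k.
  exists (\rank (lincomb XX 0)); apply/asboolP; exists 0 => //.
  by rewrite lincomb0; apply: psdmx0.
have ubP k : P k -> (k <= d)%N.
  by case/asboolP=> z _ <-; apply: rank_leq_row.
case: (ex_maxnP exP ubP) => k /asboolP[z0 pz0 <-] max.
by exists z0; split=> // z pz; apply: max; apply/asboolP; exists z.
Qed.

(** Facial reduction.  The parameters [z] for which the pencil lies in the face of a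
    feasible matrix of maximal rank form a linear space, the row space of [kermx A]
    below; it contains all feasible parameters.  Compressing the pencil by the
    right inverse [D] of the Cholesky factor turns that matrix into the identity. *)
Lemma cone_pattern n (K : set 'rV[R]_n) s d (XX : 'I_s -> 'M[R]_d) (L : 'M[R]_(s, n.+1)) :
  (forall l, (XX l)^T = XX l) ->
  (forall a, K a -> exists2 z : 'rV_s, psdmx (lincomb XX z) & homog a = z *m L) ->
  (forall f (z : 'rV_s), nonneg_cone K f -> psdmx (lincomb XX z) ->
     0 <= (z *m L *m f^T) ord0 ord0) ->
  exists p : pattern R n, (forall a, K a -> primal p idfun a) /\
    (forall f, nonneg_cone K f -> dual p idfun f).
Proof.
move=> symX KX posX; have [z0 [pz0 max]] := max_rank_psd XX.
have [r [C [D [X0E CD]]]] := psdmx_cholesky pz0.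
pose Phi z := lincomb (fun l => XX l - C^T *m (D^T *m XX l *m D) *m C) z.
have PhiE z : Phi z = lincomb XX z - C^T *m (D^T *m lincomb XX z *m D) *m C.
  rewrite !lincomb_congr /Phi /lincomb -sumrB; apply: eq_bigr => l _.
  by rewrite scalerBr.
pose A : 'M[R]_(s, d * d) := \matrix_l mxvec (XX l - C^T *m (D^T *m XX l *m D) *m C).
have AE (z : 'rV_s) : z *m A = mxvec (Phi z).
  rewrite mulmx_sum_row linear_sum; apply: eq_bigr => l _.
  by rewrite linearZ /= rowK.
have face (z : 'rV_s) : psdmx (lincomb XX z) -> exists w : 'rV_s, z = w *m kermx A.
  move=> pz; apply/submxP/sub_kermxP; rewrite AE PhiE.
  rewrite -(psdmx_max_rank pz0 pz _ X0E CD) ?subrr ?linear0 //.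
  by rewrite -lincombD max // lincombD; apply: psdmxD.
have unface (w : 'rV_s) : lincomb XX (w *m kermx A) =
    C^T *m (D^T *m lincomb XX (w *m kermx A) *m D) *m C.
  apply/eqP; rewrite -subr_eq0 -PhiE.
  have := AE (w *m kermx A); rewrite -mulmxA mulmx_ker mulmx0 => /esym/eqP.
  by rewrite mxvec_eq0.
pose YY l := D^T *m lincomb XX (row l (kermx A)) *m D.
have symY l : (YY l)^T = YY l.
  by rewrite /YY !trmx_mul trmxK lincomb_tr // mulmxA.
have YE w : lincomb YY w = D^T *m lincomb XX (w *m kermx A) *m D.
  by rewrite lincomb_mul -lincomb_congr.
have XYE w : lincomb XX (w *m kermx A) = C^T *m lincomb YY w *m C.
  by rewrite YE -unface.
have DC : D^T *m (C^T *m C) *m D = 1%:M.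
  by rewrite !mulmxA -trmx_mul CD trmx1 mul1mx.
pose p := Pattern (kermx A *m L) symY.
have penE w : @pencil R n p R idfun w = lincomb YY w.
  by apply: eq_bigr => l _; rewrite map_mx_id.
exists p; split=> [a /KX[z pz az]|f fK].
  have [w zE] := face z pz; exists w; split; last by rewrite penE YE -zE; apply: psdmx_congr.
  by rewrite az zE map_mx_id // -mulmxA.
have [w0 z0E] := face z0 pz0.
have [||y py|G [pG GE]] := @psd_duality R s r YY (kermx A *m L *m f^T) w0.
- exact: symY.
- by rewrite YE -z0E X0E DC.
- have -> : y *m (kermx A *m L *m f^T) = y *m kermx A *m L *m f^T by rewrite !mulmxA.
  by apply: posX => //; rewrite XYE; apply: psdmx_congr.
exists G; split=> // l /=; rewrite !map_mx_id // -GE.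
Qed.

(** The affine linear matrix inequality is homogenized with an additional parameter
    [t], required to be nonnegative.  On feasible parameters with [t = 0] a function
    nonnegative on [K] is still nonnegative, as these are recession directions from
    any feasible point. *)
Lemma shadow_pattern n (K : set 'rV[R]_n) : K !=set0 -> spectrahedral_shadow K ->
  exists p : pattern R n, (forall a, K a -> primal p idfun a) /\
    (forall f, nonneg_cone K f -> dual p idfun f).
Proof.
move=> [a1 Ka1] [s [Dset [L [b [[d [A0 [A [symA0 symA DE]]]] KE]]]]].
pose XX (l : 'I_(1 + s)) : 'M[R]_(1 + d) := match split l with
  | inl _ => block_mx 1%:M 0 0 A0
  | inr j => block_mx 0 0 0 (A j)
  end.
have symXX l : (XX l)^T = XX l.
  by rewrite /XX; case: split => j; rewrite tr_block_mx !trmx0 ?trmx1 ?symA ?symA0.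
have XE t (x : 'rV[R]_s) : lincomb XX (row_mx t%:M x) =
    block_mx t%:M 0 0 (t *: A0 + \sum_j x ord0 j *: A j).
  rewrite /lincomb big_split_ord big_ord1 /= row_mxEl [t%:M _ _]mxE eqxx mulr1n.
  have -> : XX (lshift s ord0) = block_mx 1%:M 0 0 A0 by rewrite /XX (unsplitK (inl _)).
  have -> : \sum_j row_mx t%:M x ord0 (rshift 1 j) *: XX (rshift 1 j) =
      block_mx 0 0 0 (\sum_j x ord0 j *: A j).
    have E j : row_mx t%:M x ord0 (rshift 1 j) *: XX (rshift 1 j) =
        block_mx 0 0 0 (x ord0 j *: A j).
      by rewrite row_mxEr /XX (unsplitK (inr _)) scale_block_mx !scaler0.
    under eq_bigr do rewrite E.
    elim: (index_enum _) => [|j l IHl]; first by rewrite !big_nil block_mx0.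
    by rewrite !big_cons IHl add_block_mx !addr0.
  by rewrite scale_block_mx add_block_mx !scaler0 !addr0 scalemx1.
have pX t (x : 'rV[R]_s) : psdmx (lincomb XX (row_mx t%:M x)) <->
    0 <= t /\ psdmx (t *: A0 + \sum_j x ord0 j *: A j).
  by rewrite XE psdmx_block psdmx_11.
pose Lam : 'M[R]_(1 + s, 1 + n) := block_mx 1%:M b 0 L.
have LamE t (x : 'rV[R]_s) : row_mx t%:M x *m Lam = row_mx t%:M (x *m L + t *: b).
  by rewrite mul_row_block mulmx1 mulmx0 addr0 mul_scalar_mx addrC.
have feas x : Dset x <-> psdmx (lincomb XX (row_mx 1%:M x)).
  by rewrite pX DE ler01 scale1r; split=> [|[]].
have homogE (x : 'rV[R]_s) : homog (x *m L + b) = row_mx 1%:M x *m Lam :> 'rV_(1 + n).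
  rewrite LamE scale1r /homog; congr row_mx.
apply: (@cone_pattern n K (1 + s) (1 + d) XX Lam) => //.
  move=> a; rewrite KE => -[x /feas px <-].
  by exists (row_mx 1%:M x).
have inK (x : 'rV[R]_s) : psdmx (lincomb XX (row_mx 1%:M x)) -> K (x *m L + b).
  by move=> px; rewrite KE; exists x; first exact/feas.
move=> f z fK; pose V (z : 'rV_(1 + s)) := (z *m Lam *m f^T) ord0 ord0.
have VD z1 z2 : V (z1 + z2) = V z1 + V z2 by rewrite /V !mulmxDl [LHS]mxE.
have VZ c z1 : V (c *: z1) = c * V z1 by rewrite /V -!scalemxAl [LHS]mxE.
have Vpos t (x : 'rV[R]_s) : 0 < t -> psdmx (lincomb XX (row_mx t%:M x)) -> 0 <= V (row_mx t%:M x).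
  move=> t0 px; have E : t^-1 *: row_mx t%:M x = row_mx 1%:M (t^-1 *: x).
    by rewrite scale_row_mx scale_scalar_mx mulVf ?gt_eqF.
  have : 0 <= V (t^-1 *: row_mx t%:M x).
    have ti0 : 0 <= t^-1 by rewrite invr_ge0 ltW.
    have := fK _ (inK (t^-1 *: x) _); rewrite lin_evalE homogE -E; apply.
    by rewrite lincombZ; apply: psdmxZ.
  by rewrite VZ pmulr_rge0 // invr_gt0.
have [x1 /feas px1] : exists x, Dset x by move: Ka1; rewrite KE => -[x Dx _]; exists x.
rewrite -/(V z) -[z](@hsubmxK _ 1 1 s) [lsubmx z]mx11_scalar.
move: (lsubmx z _ _) (rsubmx z) => t x px; have [t0 _] := (pX t x).1 px.
have Vray c : 0 <= c -> 0 <= V (row_mx 1%:M x1) + c * V (row_mx t%:M x).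
  move=> c0; rewrite -VZ -VD.
  have E : row_mx 1%:M x1 + c *: row_mx t%:M x = row_mx (1 + c * t)%:M (x1 + c *: x).
    by rewrite scale_row_mx add_row_mx scale_scalar_mx raddfD.
  rewrite E; apply: Vpos; first by rewrite ltr_wpDr ?mulr_ge0.
  by rewrite -E lincombD lincombZ; apply: psdmxD => //; apply: psdmxZ.
move: (V _) (V (row_mx t%:M x)) Vray => v1 v H.
have v1_ge0 : 0 <= v1 by have := H 0 (lexx 0); rewrite mul0r addr0.
rewrite leNgt; apply/negP => v_lt0.
have c_ge0 : 0 <= (v1 + 1) / - v.
  by apply: divr_ge0; [apply: addr_ge0 | rewrite oppr_ge0 ltW].
(* The ray issued from a feasible point reaches the value -1 at this c. *)
have := H _ c_ge0.
rewrite invrN mulrN mulNr divfK ?lt_eqF // opprD addNKr.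
by rewrite oppr_ge0 ler10.
Qed.

End ShadowPattern.

(** * From a finite family of patterns to a spectrahedral shadow *)
Section Separation.
Variables (R : realType) (n : nat).

Definition dot (x y : 'rV[R]_n) : R := \sum_j x ord0 j * y ord0 j.

Lemma dotC x y : dot x y = dot y x.
Proof. by apply: eq_bigr => j _; rewrite mulrC. Qed.

Lemma dotDl x y z : dot (x + y) z = dot x z + dot y z.
Proof. by rewrite -big_split; apply: eq_bigr => j _; rewrite mxE mulrDl. Qed.

Lemma dotZl c x z : dot (c *: x) z = c * dot x z.
Proof. by rewrite mulr_sumr; apply: eq_bigr => j _; rewrite mxE mulrA. Qed.

Lemma dotNl x z : dot (- x) z = - dot x z.
Proof. by rewrite -scaleN1r dotZl mulN1r. Qed.

Lemma dot_ge0 x : 0 <= dot x x.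
Proof. by apply: sumr_ge0 => j _; rewrite -expr2 sqr_ge0. Qed.

Lemma dot_eq0 x : dot x x = 0 -> x = 0.
Proof.
move/eqP; rewrite psumr_eq0 => [/allP x0|j _]; last by rewrite -expr2 sqr_ge0.
apply/rowP => j; have := x0 j (mem_index_enum _).
by rewrite -expr2 sqrf_eq0 mxE => /eqP.
Qed.

(** Compactness of the part of [K] in a box around [a].  The half-width [M] of the box
    is at least 1, so a squared distance at most [M] forces a distance at most [M]. *)
Lemma nearest_point (K : set 'rV[R]_n) a : closed K -> K !=set0 ->
  exists2 c, K c & forall y, K y -> dot (c - a) (c - a) <= dot (y - a) (y - a).
Proof.
move=> clK [x0 Kx0]; pose q y := dot (y - a) (y - a).
pose M := q x0 + 1.
have M_ge1 : 1 <= M by rewrite lerDr dot_ge0.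
pose B := [set y : 'rV[R]_n | forall j, `[a ord0 j - M, a ord0 j + M]%classic (y ord0 j)].
have cB : compact B.
  exact: (@rV_compact _ n (fun j => `[a ord0 j - M, a ord0 j + M]%classic)
    (fun j => @segment_compact R _ _)).
have inB y : q y <= q x0 -> B y.
  move=> qy j /=; rewrite in_itv /=.
  have : (y ord0 j - a ord0 j) ^+ 2 <= M.
    apply: (@le_trans _ _ (q y)); last by apply: (le_trans qy); rewrite lerDl.
    rewrite /q /dot (bigD1 j) //= !mxE -expr2 lerDl sumr_ge0 // => i _.
    by rewrite -expr2 sqr_ge0.
  move: (y ord0 j) (a ord0 j) => u v Huv.
  have : `|u - v| <= M.
    rewrite -(ler_pXn2r (n := 2)) ?nnegrE ?normr_ge0 ?(le_trans _ M_ge1) //.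
    rewrite real_normK ?num_real //; apply: (le_trans Huv).
    by rewrite expr2 ler_peMl // (le_trans _ M_ge1).
  by rewrite ler_norml => /andP[l1 l2]; apply/andP; split; lra.
have cont : continuous q.
  have term j : continuous (fun y : 'rV[R]_n => (y - a) ord0 j * (y - a) ord0 j).
    have cj : continuous (fun y : 'rV[R]_n => (y - a) ord0 j).
      rewrite (_ : (fun y => _) = fun y : 'rV[R]_n => y ord0 j + (- a) ord0 j); last first.
        by apply/funext => y; rewrite mxE.
      move=> y; have H1 := @coord_continuous R 1 n ord0 j y.
      have H2 := @cst_continuous 'rV[R]_n R ((- a) ord0 j) y.
      exact: (cvgD H1 H2).
    by move=> y; exact: (cvgM (cj y) (cj y)).
  rewrite /q /dot; elim: (index_enum _) => [|j s IHs].
    rewrite (_ : (fun y => _) = fun=> 0); first exact: cst_continuous.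
    by apply/funext => y; rewrite big_nil.
  rewrite (_ : (fun y => _) = fun y : 'rV[R]_n => (y - a) ord0 j * (y - a) ord0 j +
      \sum_(i <- s) (y - a) ord0 i * (y - a) ord0 i); last first.
    by apply/funext => y; rewrite big_cons.
  by move=> y; exact: (cvgD (term j y) (IHs y)).
have [|||c cKB cmin] := @compact_EVT_min _ R q (K `&` B).
- by exists x0; split=> //; apply: inB.
- by rewrite setIC; apply: compact_closedI.
- by apply: continuous_subspaceT.
move: cKB; rewrite inE => -[Kc Bc]; exists c => // y Ky.
have [qy|/ltW qy] := leP (q y) (q x0).
  by apply: cmin; rewrite inE; split=> //; apply: inB.
by apply: le_trans qy; apply: cmin; rewrite inE; split=> //; apply: inB.
Qed.

Lemma convex_segment (K : set 'rV[R]_n) x y t : convex_set K -> K x -> K y ->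
  0 <= t -> t <= 1 -> K (t *: x + (1 - t) *: y).
Proof.
move=> cK Kx Ky t0 t1.
by have := cK x y (Itv01 t0 t1); rewrite !inE; apply.
Qed.

(** Otherwise a short step from [c] towards [y] would decrease the distance. *)
Lemma nearest_point_obtuse (K : set 'rV[R]_n) a c y : convex_set K -> K c ->
  (forall y, K y -> dot (c - a) (c - a) <= dot (y - a) (y - a)) ->
  K y -> 0 <= dot (y - c) (c - a).
Proof.
move=> cK Kc cmin Ky; rewrite leNgt; apply/negP.
set s := dot _ _ => s_lt0; pose N := dot (y - c) (y - c).
have N0 : 0 <= N by exact: dot_ge0.
pose t := - s / (N - s).
have D0 : 0 < N - s by rewrite subr_gt0 (lt_le_trans s_lt0).
have t0 : 0 < t by rewrite divr_gt0 // oppr_gt0.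
have t1 : t <= 1 by rewrite ler_pdivrMr // mul1r lerDr.
have := cmin _ (convex_segment cK Ky Kc (ltW t0) t1).
have -> : t *: y + (1 - t) *: c - a = t *: (y - c) + (c - a).
  by rewrite scalerBl scale1r scalerBr !addrA [t *: y + c - _]addrAC.
have -> (u v : 'rV[R]_n) : dot (t *: u + v) (t *: u + v) =
    t * (t * dot u u + dot u v) + (t * dot u v + dot v v).
  by rewrite dotDl dotZl [dot u (_ + _)]dotC [dot v (_ + _)]dotC !dotDl !dotZl [dot v u]dotC.
rewrite -/N -/s => H.
have : 0 <= t * (t * N + s + s) by move: H; lra.
rewrite pmulr_rge0 // => H'.
have tN : t * (N - s) = - s by rewrite divfK // gt_eqF.
have : t * N - t * s = - s by rewrite -mulrBr.
nra.
Qed.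

(** A point outside [K] is separated from [K] by the affine function vanishing at the
    nearest point [c], with gradient [c - a]. *)
Lemma bipolar (K : set 'rV[R]_n) a : closed K -> convex_set K ->
  (forall f, nonneg_cone K f -> 0 <= lin_eval f a) -> K a.
Proof.
move=> clK cK Ha; apply: contrapT => nKa.
have lE k (v x : 'rV[R]_n) : lin_eval (row_mx k%:M v : 'rV_(1 + n)) x = k + dot v x.
  rewrite lin_evalE (_ : (homog x *m _) = (1 : 'M_1) *m k%:M^T + x *m v^T); last first.
    by rewrite /homog (@tr_row_mx _ 1 1 n) (@mul_row_col _ 1 1 n).
  rewrite mul1mx tr_scalar_mx [LHS]mxE [k%:M _ _]mxE eqxx mulr1n; congr (_ + _).
  by rewrite mxE; apply: eq_bigr => j _; rewrite mxE mulrC.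
have [Kn0|K0] := pselect (K !=set0); last first.
  have := Ha (row_mx (-1)%:M 0 : 'rV_(1 + n)); rewrite lE /dot big1 ?addr0 ?ler0N1.
    by move=> H; suff: false by []; apply: H => x Kx; case: K0; exists x.
  by move=> j _; rewrite mxE mul0r.
have [c Kc cmin] := nearest_point a clK Kn0.
have := Ha (row_mx (- dot c (c - a))%:M (c - a) : 'rV_(1 + n)).
have E x : lin_eval (row_mx (- dot c (c - a))%:M (c - a) : 'rV_(1 + n)) x = dot (x - c) (c - a).
  by rewrite lE [dot _ x]dotC [RHS]dotDl dotNl addrC.
rewrite E => H; have : 0 <= dot (a - c) (c - a).
  by apply: H => x Kx; rewrite E; apply: nearest_point_obtuse cmin Kx.
rewrite -opprB dotNl oppr_ge0 => le0.
have : c - a = 0 by apply: dot_eq0; apply/eqP; rewrite eq_le le0 dot_ge0.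
by move/eqP; rewrite subr_eq0 => /eqP ca; apply: nKa; rewrite -ca.
Qed.

End Separation.

Section Cones.
Variable R : realType.

(** Semidefinitely representable cones. *)
Definition sdr_cone N (C : set 'rV[R]_N) : Prop :=
  exists m d (XX : 'I_m -> 'M[R]_d) (L : 'M[R]_(m, N)),
    (forall l, (XX l)^T = XX l) /\
    forall v, C v <-> exists z, psdmx (lincomb XX z) /\ v = z *m L.

Lemma sdr_cone_ext N (C C' : set 'rV[R]_N) : (forall v, C v <-> C' v) ->
  sdr_cone C -> sdr_cone C'.
Proof. by move=> CC' [m [d [XX [L [sX CE]]]]]; exists m, d, XX, L; split=> // v; rewrite -CC'. Qed.

Lemma sdr_cone0 N : sdr_cone [set (0 : 'rV[R]_N)].
Proof.
exists 0%N, 0%N, (fun=> 0), 0; split=> [l|v]; first by rewrite trmx0.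
split=> [->|[z [_ ->]]]; last by rewrite mulmx0.
by exists 0; rewrite mulmx0 lincomb0; split=> //; apply: psdmx0.
Qed.

Lemma sdr_coneT N : sdr_cone [set: 'rV[R]_N].
Proof.
exists N, 0%N, (fun=> 0), 1%:M; split=> [l|v]; first by rewrite trmx0.
split=> // _; exists v; rewrite mulmx1; split=> //.
by rewrite [lincomb _ _]big1 => [|l _]; [exact: psdmx0 | rewrite scaler0].
Qed.

(** Two inequalities in linear functions of the same parameters are equivalent to a
    single block diagonal one. *)
Lemma lincomb_block m1 m2 m d1 d2 (XX1 : 'I_m1 -> 'M[R]_d1) (XX2 : 'I_m2 -> 'M[R]_d2)
    (A1 : 'M[R]_(m, m1)) (A2 : 'M[R]_(m, m2)) :
  (forall l, (XX1 l)^T = XX1 l) -> (forall l, (XX2 l)^T = XX2 l) ->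
  exists XX : 'I_m -> 'M[R]_(d1 + d2), (forall l, (XX l)^T = XX l) /\
    forall z, psdmx (lincomb XX z) <->
      psdmx (lincomb XX1 (z *m A1)) /\ psdmx (lincomb XX2 (z *m A2)).
Proof.
move=> s1 s2.
exists (fun l => block_mx (lincomb XX1 (row l A1)) 0 0 (lincomb XX2 (row l A2))).
split=> [l|z]; first by rewrite tr_block_mx !trmx0 !lincomb_tr.
rewrite !lincomb_mul -psdmx_block; set M := lincomb _ z; set M' := block_mx _ _ _ _.
suff -> : M = M' by [].
rewrite /M /M' /lincomb; elim: (index_enum _) => [|l s IHs].
  by rewrite !big_nil block_mx0.
by rewrite !big_cons IHs scale_block_mx add_block_mx !scaler0 !addr0.
Qed.

Lemma sdr_cone_sum N (C1 C2 : set 'rV[R]_N) : sdr_cone C1 -> sdr_cone C2 ->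
  sdr_cone [set v | exists v1 v2, [/\ C1 v1, C2 v2 & v = v1 + v2]].
Proof.
case=> m1 [d1 [XX1 [L1 [s1 C1E]]]] [m2 [d2 [XX2 [L2 [s2 C2E]]]]].
have [XX [sX XE]] := lincomb_block (col_mx 1%:M 0 : 'M_(m1 + m2, m1)) (col_mx 0 1%:M) s1 s2.
exists (m1 + m2)%N, (d1 + d2)%N, XX, (col_mx L1 L2); split=> // v; split.
  case=> v1 [v2 [/C1E[z1 [p1 ->]] /C2E[z2 [p2 ->]] ->]].
  exists (row_mx z1 z2); rewrite XE !mul_row_col !mulmx1 !mulmx0 addr0 add0r.
  by split.
case=> z [/XE]; rewrite -[z]hsubmxK !mul_row_col !mulmx1 !mulmx0 addr0 add0r.
move=> [p1 p2] ->; exists (lsubmx z *m L1), (rsubmx z *m L2); split=> //.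
  by apply/C1E; exists (lsubmx z).
by apply/C2E; exists (rsubmx z).
Qed.

Lemma sdr_cone_cap N (C1 C2 : set 'rV[R]_N) : sdr_cone C1 -> sdr_cone C2 ->
  sdr_cone [set v | C1 v /\ C2 v].
Proof.
case=> m1 [d1 [XX1 [L1 [s1 C1E]]]] [m2 [d2 [XX2 [L2 [s2 C2E]]]]].
(* the pairs of parameters with the same image form the row space of E *)
pose E := kermx (col_mx L1 (- L2)).
pose A1 := E *m col_mx 1%:M 0; pose A2 := E *m col_mx 0 1%:M.
have [XX [sX XE]] := lincomb_block A1 A2 s1 s2.
exists (m1 + m2)%N, (d1 + d2)%N, XX, (A1 *m L1); split=> // v; split.
  case=> /C1E[z1 [p1 v1]] /C2E[z2 [p2 v2]].
  have /sub_kermxP/submxP[w wE] : row_mx z1 z2 *m col_mx L1 (- L2) = 0.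
    by rewrite mul_row_col mulmxN -v1 -v2 subrr.
  have w1 : w *m A1 = z1 by rewrite mulmxA -wE mul_row_col mulmx1 mulmx0 addr0.
  have w2 : w *m A2 = z2 by rewrite mulmxA -wE mul_row_col mulmx1 mulmx0 add0r.
  by exists w; rewrite XE w1 w2 v1 mulmxA w1.
case=> w [/XE[p1 p2] ->].
have EE : A1 *m L1 = A2 *m L2.
  apply/eqP; rewrite -subr_eq0 -mulmxN; apply/eqP.
  transitivity (E *m col_mx L1 (- L2)); last exact: mulmx_ker.
  rewrite /A1 /A2 -!(mulmxA E) -mulmxDr !mul_col_mx !mul1mx !mul0mx.
  by rewrite add_col_mx addr0 add0r.
split; first by apply/C1E; exists (w *m A1); split=> //; exact: mulmxA.
by apply/C2E; exists (w *m A2); split=> //; rewrite EE; exact: mulmxA.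
Qed.

Lemma sdr_cone_bigcap N (I : eqType) (C : I -> set 'rV[R]_N) (s : seq I) :
  (forall i, sdr_cone (C i)) -> sdr_cone [set v | forall i, i \in s -> C i v].
Proof.
move=> HC; elim: s => [|i s IHs]; first exact: sdr_cone_ext (sdr_coneT N).
apply: sdr_cone_ext (sdr_cone_cap (HC i) IHs) => v; split.
  by case=> Ci Cs j; rewrite inE => /predU1P[->|/Cs].
by move=> H; split=> [|j js]; apply: H; rewrite inE ?eqxx ?js ?orbT.
Qed.

(** The equation expressing height one is encoded by two scalar blocks. *)
Lemma sdr_cone_shadow n (C : set 'rV[R]_n.+1) : sdr_cone C ->
  spectrahedral_shadow [set a | C (homog a)].
Proof.
case=> m [d [XX [L [sX CE]]]]; pose ell (l : 'I_m) := L l ord0.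
pose A0 : 'M[R]_(d + 1 + 1) := block_mx (block_mx 0 0 0 (-1)%:M) 0 0 1%:M.
pose A l : 'M[R]_(d + 1 + 1) :=
  block_mx (block_mx (XX l) 0 0 (ell l)%:M) 0 0 (- ell l)%:M.
pose D : set 'rV[R]_m := [set z | psdmx (A0 + \sum_l z ord0 l *: A l)].
have AE (z : 'rV[R]_m) : \sum_l z ord0 l *: A l =
    block_mx (block_mx (lincomb XX z) 0 0 ((z *m L) ord0 ord0)%:M) 0 0 (- (z *m L) ord0 ord0)%:M.
  rewrite mxE /lincomb; elim: (index_enum _) => [|l s IHs].
    by rewrite !big_nil oppr0 !raddf0 !block_mx0.
  rewrite !big_cons IHs !scale_block_mx !add_block_mx !scaler0 !addr0.
  by rewrite !scale_scalar_mx mulrN opprD !raddfD.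
have DE z : D z <-> psdmx (lincomb XX z) /\ (z *m L) ord0 ord0 = 1.
  rewrite /D /= AE !add_block_mx !addr0 add0r !psdmx_block -!raddfD /= !psdmx_11.
  split=> [[[pz le1] le2]|[pz ->]]; last by rewrite addNr subrr lexx.
  split=> //; apply/eqP; rewrite eq_le; apply/andP; split; lra.
exists m, D, (rsubmx (L : 'M_(m, 1 + n))), 0; split.
  exists (d + 1 + 1)%N, A0, A; split=> // [|l].
    by rewrite !tr_block_mx !trmx0 !tr_scalar_mx.
  by rewrite !tr_block_mx !trmx0 !tr_scalar_mx sX.
apply/seteqP; split=> a /=.
  case/CE=> z [pz aE]; exists z; first by apply/DE; rewrite -aE homog0.
  rewrite addr0 -[a](@row_mxKr _ 1 1 n 1) -/(homog a) aE.
  by apply/rowP => j; rewrite !mxE; apply: eq_bigr => l _; rewrite mxE.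
case=> z /DE[pz z1] <-; apply/CE; exists z; split=> //.
rewrite addr0; apply/rowP => j; case: (unliftP ord0 j) => [k|] ->.
  rewrite homogS !mxE; apply: eq_bigr => l _.
  by rewrite mxE rshift1.
by rewrite homog0 z1.
Qed.

Definition fold_sum N (I : Type) (C : I -> set 'rV[R]_N) (s : seq I) : set 'rV[R]_N :=
  foldr (fun i T => [set v | exists v1 v2, [/\ C i v1, T v2 & v = v1 + v2]]) [set 0] s.

Lemma sdr_cone_fold_sum N (I : Type) (C : I -> set 'rV[R]_N) (s : seq I) :
  (forall i, sdr_cone (C i)) -> sdr_cone (fold_sum C s).
Proof.
by move=> HC; elim: s => [|i s IHs] /=; [exact: sdr_cone0 | exact: sdr_cone_sum].
Qed.

Lemma fold_sum_mem N (I : eqType) (C : I -> set 'rV[R]_N) (s : seq I) i v :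
  (forall i, C i 0) -> i \in s -> C i v -> fold_sum C s v.
Proof.
move=> C0; have S0 t : fold_sum C t 0.
  by elim: t => [|j t IHt] //=; exists 0, 0; rewrite addr0.
elim: s => [|j s IHs] //=; rewrite inE => /predU1P[->|si] Civ.
  by exists v, 0; rewrite addr0.
by exists 0, v; rewrite add0r; split=> //; apply: IHs.
Qed.

Lemma fold_sum_ge0 N (I : eqType) (C : I -> set 'rV[R]_N) (s : seq I) (f : 'rV[R]_N) v :
  (forall i w, i \in s -> C i w -> 0 <= (w *m f^T) ord0 ord0) ->
  fold_sum C s v -> 0 <= (v *m f^T) ord0 ord0.
Proof.
elim: s v => [|i s IHs] v H /=; first by move=> ->; rewrite mul0mx mxE.
case=> v1 [v2 [Cv1 Sv2 ->]]; rewrite mulmxDl [X in 0 <= X]mxE addr_ge0 //.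
  by apply: (H i) => //; rewrite inE eqxx.
by apply: IHs => // j w js; apply: H; rewrite inE js orbT.
Qed.

Lemma pattern_cone n (p : pattern R n) : sdr_cone [set v |
  exists e, psdmx (@pencil R n p R idfun e) /\ v = e *m map_mx idfun (pat_lin p)].
Proof.
exists (pat_dim p), (pat_size p), (pat_mx p), (map_mx idfun (pat_lin p)).
split=> [l|v]; first exact: pat_sym.
by split=> -[e [pe ->]]; exists e; split=> //; move: pe;
  rewrite /pencil; under eq_bigr do rewrite map_mx_id //.
Qed.

(** For a set [I] of patterns let [E I] be the intersection of their primal cones, and
    call [I] good when the dual parts of the patterns in [I] cover the affine
    functions nonnegative on [K].  On [E I], for good [I], these functions are
    nonnegative, hence also on the sum [T] of these cones; by biduality the section
    of [T] at height one is contained in [K].  Conversely the patterns that serve a point of [K] form a good set. *)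
Lemma finite_cover_shadow n (K : set 'rV[R]_n) N (p : 'I_N -> pattern R n) :
  closed K -> convex_set K ->
  (forall a f, K a -> nonneg_cone K f ->
    exists i, primal (p i) idfun a /\ dual (p i) idfun f) ->
  spectrahedral_shadow K.
Proof.
move=> clK cK cover.
pose C i : set 'rV[R]_n.+1 := [set v |
  exists e, psdmx (@pencil R n (p i) R idfun e) /\ v = e *m map_mx idfun (pat_lin (p i))].
pose E (I : {set 'I_N}) := [set v | forall i, i \in enum I -> C i v].
pose good (I : {set 'I_N}) := `[< forall f, nonneg_cone K f ->
  exists2 i, i \in I & dual (p i) idfun f >].
pose T := fold_sum E (enum good).
have sdrT : sdr_cone T.
  by apply: sdr_cone_fold_sum => I; apply: sdr_cone_bigcap => i; apply: pattern_cone.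
suff -> : K = [set a | T (homog a)] by apply: sdr_cone_shadow.
apply/seteqP; split=> a /=.
  move=> Ka; pose I := [set i | `[< primal (p i) idfun a >]]%SET.
  apply: (@fold_sum_mem _ _ E _ I).
  - move=> J i _; exists 0; rewrite mul0mx; split=> //.
    rewrite /pencil big1 => [|l _]; first exact: psdmx0.
    by rewrite mxE scale0r.
  - rewrite mem_enum; apply/asboolP => f fK; have [i [ai fi]] := cover a f Ka fK.
    by exists i; rewrite // inE; apply/asboolP.
  - move=> i; rewrite mem_enum inE => /asboolP[e [aE pe]].
    by exists e.
move=> Ta; apply: bipolar => // f fK; rewrite lin_evalE.
apply: fold_sum_ge0 Ta => I w; rewrite mem_enum => /asboolP/(_ f fK)[i iI fi] Ew.
have [|e [pe ->]] := Ew i; first by rewrite mem_enum.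
exact: cone_dual_ge0 pe fi.
Qed.

End Cones.

(** * Compactness, and the equivalence *)
Lemma definable_nonneg (F : rcfType) n (psi : safm F n) :
  definable (fun (S : rcfType) (h : {rmorphism F -> S}) f =>
    nonneg_cone (sa_set (sa_map h psi)) f).
Proof.
have Hx : definable (fun (S : rcfType) (h : {rmorphism F -> S}) (z : 'rV[S]_(n.+1 + n)) =>
    sa_set (sa_map h psi) (rsubmx z)).
  apply: definable_subst (definable_sa psi) => j.
  by apply: polyfun_ext (polyfun_coord F (rshift n.+1 j)) => S h z; rewrite mxE.
have coordl j : @polyfun F (n.+1 + n) (fun S h z => lsubmx z ord0 j).
  by apply: polyfun_ext (polyfun_coord F (lshift n j)) => S h z; rewrite mxE.
have coordr j : @polyfun F (n.+1 + n) (fun S h z => rsubmx z ord0 j).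
  by apply: polyfun_ext (polyfun_coord F (rshift n.+1 j)) => S h z; rewrite mxE.
have Hl : @polyfun F (n.+1 + n) (fun S h z => lin_eval (lsubmx z) (rsubmx z)).
  apply: polyfun_add (coordl ord0) _; apply: polyfun_sum => j.
  exact: polyfun_mul.
apply: definable_ext (definable_forall (definable_imp Hx (definable_ge0 Hl))) => S h f.
by split=> H x; have := H x; rewrite row_mxKl row_mxKr.
Qed.

(** The theorem of Los for all definable families, the quantifiers having been
    eliminated. *)
Lemma definable_ultrapower (F : rcfType) (I : Type) (U : set_system I)
    (UU : UltraFilter U) n (P : set_family F n) (u : I -> 'rV[F]_n) : definable P ->
  P (ultrapower F UU) (udiag UU) (uclass_rV UU u) <-> U [set j | P F idfun (u j)].
Proof.
case=> phi Hphi; rewrite -Hphi ultrapower_sa_set.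
suff -> : [set j | P F idfun (u j)] = [set j | sa_set phi (u j)] by [].
by apply/funext => j; apply/propext; rewrite /= -Hphi sa_set_idfun.
Qed.

HB.instance Definition _ (F : comNzRingType) n := gen_eqMixin (pattern F n).

(** Otherwise every finite list of patterns misses a pair.  In an ultrapower along a
    filter containing, for every pattern, the set of the lists to which it belongs,
    the classes of these pairs satisfy no pattern. *)
Lemma finitely_many_patterns (F : rcfType) n (A : set 'rV[F]_n) (B : set 'rV[F]_n.+1) :
  semialgebraic A -> semialgebraic B ->
  (forall (S : rcfType) (h : {rmorphism F -> S}) a f, base_ext h A a -> base_ext h B f ->
     exists p : pattern F n, primal p h a /\ dual p h f) ->
  exists N (p : 'I_N -> pattern F n), forall a f, A a -> B f ->
    exists i, primal (p i) idfun a /\ dual (p i) idfun f.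
Proof.
case=> phiA -> [phiB ->] H; apply: contrapT => ncover.
have bad (s : seq (pattern F n)) : exists x : 'rV[F]_n * 'rV[F]_n.+1,
    [/\ sa_set phiA x.1, sa_set phiB x.2 &
     forall p, p \in s -> ~ (primal p idfun x.1 /\ dual p idfun x.2)].
  apply: contrapT => good; apply: ncover.
  exists (size s), (tnth (in_tuple s)) => a f Aa Bf.
  apply: contrapT => nai; apply: good; exists (a, f); split=> // p ps paf.
  by case: nai; have /tnthP[i pE] := (ps : p \in in_tuple s); exists i; rewrite -pE.
have [x xP] := choice bad.
pose tails : set_system (seq (pattern F n)) :=
  [set T | exists s : seq (pattern F n), forall t : seq (pattern F n),
     {subset s <= t} -> T t].
have tails_proper : ProperFilter tails.
  apply: Build_ProperFilter_ex => [T [s Ts]|]; first by exists s; apply: Ts.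
  split=> [|T T' [s Ts] [s' Ts']|T T' TT' [s Ts]].
  - by exists [::].
  - exists (s ++ s') => t st; split; [apply: Ts | apply: Ts'] => p ps;
      by apply: st; rewrite mem_cat ps ?orbT.
  - by exists s => t st; apply/TT'/Ts.
have [U [UU tailsU]] := ultraFilterLemma tails_proper.
pose a := uclass_rV UU (fun s => (x s).1); pose f := uclass_rV UU (fun s => (x s).2).
have [||p [pa pf]] := H (ultrapower F UU) (udiag UU) a f.
- by apply/base_extE/ultrapower_sa_set; apply: filterS filterT => s _; case: (xP s).
- by apply/base_extE/ultrapower_sa_set; apply: filterS filterT => s _; case: (xP s).
have Ua : U [set s | primal p idfun (x s).1].
  exact/(definable_ultrapower _ _ (definable_primal p)).
have Uf : U [set s | dual p idfun (x s).2].
  exact/(definable_ultrapower _ _ (definable_dual p)).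
have Up : U [set s : seq (pattern F n) | p \in s].
  by apply: tailsU; exists [:: p] => t; apply; rewrite inE.
have properU := @ultra_proper _ _ UU.
have : U set0; last exact: filter_not_empty.
apply: filterS3 Ua Uf Up => s /= pa' pf' ps.
by case: (xP s) => _ _ /(_ p ps); apply.
Qed.

Theorem corollary3p19 (R : realType) (n : nat) (K : set 'rV[R]_n)
    (K_closed : closed K) (K_convex : convex_set K) (K_sa : semialgebraic K) :
  spectrahedral_shadow K <->
  forall (S : rcfType) (iota : {rmorphism R -> S})
      (f : 'rV[S]_n.+1) (a : 'rV[S]_n),
    base_ext iota (nonneg_cone K) f -> base_ext iota K a ->
    sum_of_squares (tensor_eval iota f a).
Proof.
have [psi KE] := K_sa; have Npsi := definable_nonneg psi.
have psiE : sa_set (sa_map idfun psi) = K.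
  by rewrite KE; apply/seteqP; split=> x; rewrite sa_set_idfun.
split=> [shadow S h f a fK aK|H].
  have fN : nonneg_cone (sa_set (sa_map h psi)) f.
    by rewrite -(base_ext_definable h f Npsi) psiE.
  have {}aK : sa_set (sa_map h psi) a by move: aK; rewrite {1}KE => /base_extE.
  have [K0|K0] := pselect (K !=set0); last first.
    have := @transfer R n (fun S h a => ~ sa_set (sa_map h psi) a) _ _ S h a.
    case=> //; first exact: definable_not (definable_sa psi).
    by move=> y; rewrite psiE => Ky; apply: K0; exists y.
  have [p [pK pN]] := shadow_pattern K0 shadow.
  apply: (@pattern_tensor_eval R n p S h a f).
    move: aK; apply: (@transfer R n (fun S h a => sa_set (sa_map h psi) a -> primal p h a)).
      exact: definable_imp (definable_sa psi) (definable_primal p).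
    by move=> y; rewrite psiE; apply: pK.
  move: fN; apply: (@transfer R n.+1
    (fun S h f => nonneg_cone (sa_set (sa_map h psi)) f -> dual p h f)).
    exact: definable_imp Npsi (definable_dual p).
  by move=> y; rewrite psiE; apply: pN.
have [|||N [p cover]] := @finitely_many_patterns R n K (nonneg_cone K).
- exact: K_sa.
- case: Npsi => phi Hphi; exists phi.
  by rewrite -{1}psiE; apply/seteqP; split=> y; rewrite -Hphi sa_set_idfun.
- by move=> S h a f aK fK; apply: sum_of_squares_pattern; apply: H.
exact: finite_cover_shadow cover.
Qed.
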